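(* Let $(G,i)$ be a rooted graph with $G$ connected. The following are equivalent: (a) $(G,i)$ allows the nullity pair $(1,2)$ with the SNIP; (b) $(G,i)$ contains $(\mathrm{Paw},i)$ or $(S(2,1,1),i)$ as a rooted minor; (c) $(G,i)$ is not a yam graph.
   Context: All matrices are real. For a simple graph $G$ on $[n]$, $\mathcal{S}(G)$ is the set of real symmetric $n\times n$ matrices whose off-diagonal $(j,k)$ entry is nonzero iff $\{j,k\}\in E(G)$ (diagonal free). $A(i)$ is $A$ with row and column $i$ deleted; the $i$-nullity pair of $A$ is $(\operatorname{null}(A),\operatorname{null}(A(i)))$. $A$ has the $i$-SNIP if $X=O$ is the only real symmetric $X$ with $A\circ X=O$, $I\circ X=O$ and $(AX)(i,:]=O$ ($AX$ with row $i$ deleted). $(G,i)$ allows $(k,\ell)$ with the SNIP if some $A\in\mathcal{S}(G)$ has $i$-nullity pair $(k,\ell)$ and the $i$-SNIP. $(G,i)$ is a rooted minor of $(H,i)$ if obtainable from $(H,i)$ by edge deletions, deletions of isolated non-root vertices, and edge contractions (new vertex is the root if the contracted edge contains the root). $(\mathrm{Paw},i)$: vertices $i,a,b,c$ with edges $ia, ab, ac, bc$, rooted at $i$. $(S(2,1,1),i)$: vertices $i,a,b,c,d$ with edges $ia, ab, bc, bd$, rooted at $i$. A generalized star is a tree with exactly one vertex of degree at least $3$ (its center). A yam graph is a connected rooted graph $(G,i)$ such that each component of $G-i$ is a generalized star or a path, and for each component of $G-i$ that is a generalized star, $i$ is adjacent only to its center (among the vertices of that component). *)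

(* Defs.v *)
From HB Require Import structures.
From mathcomp Require Import all_boot all_order all_algebra.
From mathcomp Require Import reals.

Set Implicit Arguments.
Unset Strict Implicit.
Unset Printing Implicit Defensive.

Import GRing.Theory.
Local Open Scope ring_scope.

Record sgraph (T : finType) := SGraph {
  adj :> rel T;
  adj_sym : symmetric adj;
  adj_irr : irreflexive adj
}.

Record rgraph := RGraph {
  vertex : finType;
  graph : sgraph vertex;
  root : vertex
}.

Section Graphs.
Variables (T : finType) (G : sgraph T).

Definition deg (x : T) : nat := #|[set y | adj G x y]|.

Definition connected_graph : Prop := forall x y : T, connect (adj G) x y.

Definition has_cycle : Prop := exists s : seq T, (2 < size s)%N /\ ucycle (adj G) s.

Definition is_tree : Prop := [/\ inhabited T, connected_graph & ~ has_cycle].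

(* Isomorphic to the path on m + 1 vertices; a single vertex is a path. *)
Definition is_path : Prop :=
  exists (m : nat) (f : 'I_m.+1 -> T), bijective f /\
    forall a b, adj G (f a) (f b) = (a.+1 == b :> nat) || (b.+1 == a :> nat).

Definition generalized_star : Prop := is_tree /\ exists! c : T, (3 <= deg c)%N.

Definition star_center (c : T) : Prop := generalized_star /\ (3 <= deg c)%N.

Definition component (x : T) : {set T} := [set y | connect (adj G) x y].

Section Induced.
Variable W : {set T}.

Definition induced_adj : rel {x : T | x \in W} :=
  fun x y => adj G (val x) (val y).

Lemma induced_sym : symmetric induced_adj.
Proof. by move=> x y; apply: adj_sym. Qed.

Lemma induced_irr : irreflexive induced_adj.
Proof. by move=> x; apply: adj_irr. Qed.

Definition induced : sgraph {x : T | x \in W} := SGraph induced_sym induced_irr.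
End Induced.

End Graphs.

Definition yam_graph (H : rgraph) : Prop :=
  let G := graph H in
  let i := root H in
  let Gi := induced G [set~ i] in
  connected_graph G /\
  forall x : {x | x \in [set~ i]},
    let C := component Gi x in
    let GC := induced Gi C in
    (generalized_star GC \/ is_path GC) /\
    (generalized_star GC ->
     forall z : {y | y \in C}, adj G i (val (val z)) -> star_center GC z).

(* The three minor operations are stated up to isomorphism: [op H G] means that
   G is isomorphic to a graph obtained from H by one operation, as witnessed by
   the map f. *)
Definition edge_deletion (H G : rgraph) : Prop :=
  exists (u v : vertex H) (f : vertex H -> vertex G),
    [/\ adj (graph H) u v, bijective f, f (root H) = root G &
        forall x y, adj (graph G) (f x) (f y) =
                    adj (graph H) x y && ([set x; y] != [set u; v])].

Definition isolated_vertex_deletion (H G : rgraph) : Prop :=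
  exists (v : vertex H) (f : vertex G -> vertex H),
    [/\ v != root H /\ (forall x, ~~ adj (graph H) v x),
        injective f /\ (forall x, (x \in codom f) = (x != v)),
        f (root G) = root H &
        forall x y, adj (graph G) x y = adj (graph H) (f x) (f y)].

(* f is the quotient map that identifies u and v; loops and parallel edges that
   arise are discarded. *)
Definition edge_contraction (H G : rgraph) : Prop :=
  exists (u v : vertex H) (f : vertex H -> vertex G),
    [/\ adj (graph H) u v,
        (forall p, exists x, f x = p) /\
        (forall x y, f x = f y <-> x = y \/ [set x; y] = [set u; v]),
        f (root H) = root G &
        forall p q, adj (graph G) p q <->
          p <> q /\ exists x y, [/\ f x = p, f y = q & adj (graph H) x y]].

Definition rooted_iso (H G : rgraph) : Prop :=
  exists f : vertex H -> vertex G,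
    [/\ bijective f, f (root H) = root G &
        forall x y, adj (graph G) (f x) (f y) = adj (graph H) x y].

Inductive rooted_minor (G : rgraph) : rgraph -> Prop :=
| minor_iso H : rooted_iso H G -> rooted_minor G H
| minor_edge_deletion H H' :
    edge_deletion H H' -> rooted_minor G H' -> rooted_minor G H
| minor_isolated_vertex_deletion H H' :
    isolated_vertex_deletion H H' -> rooted_minor G H' -> rooted_minor G H
| minor_edge_contraction H H' :
    edge_contraction H H' -> rooted_minor G H' -> rooted_minor G H.

Section EdgeList.
Variables (n : nat) (E : seq (nat * nat)).

Definition edge_list_adj : rel 'I_n := fun x y =>
  (x != y) && (((val x, val y) \in E) || ((val y, val x) \in E)).

Lemma edge_list_sym : symmetric edge_list_adj.
Proof. by move=> x y; rewrite /edge_list_adj eq_sym orbC. Qed.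

Lemma edge_list_irr : irreflexive edge_list_adj.
Proof. by move=> x; rewrite /edge_list_adj eqxx. Qed.

Definition edge_list_graph : sgraph 'I_n := SGraph edge_list_sym edge_list_irr.
End EdgeList.

(* i, a, b, c = 0, 1, 2, 3 *)
Definition Paw : rgraph :=
  RGraph (edge_list_graph 4 [:: (0, 1); (1, 2); (1, 3); (2, 3)]%N) ord0.

(* i, a, b, c, d = 0, 1, 2, 3, 4 *)
Definition S211 : rgraph :=
  RGraph (edge_list_graph 5 [:: (0, 1); (1, 2); (2, 3); (2, 4)]%N) ord0.

Section Matrices.
Variables (R : realType) (n : nat).

Definition in_S (G : sgraph 'I_n) (A : 'M[R]_n) : Prop :=
  A^T = A /\ forall j k, j != k -> (A j k != 0) = adj G j k.

(* The columns of [cokermx A] span {v | A v = 0}. *)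
Definition nullity (m : nat) (A : 'M[R]_m) : nat := \rank (cokermx A).

Definition nullity_pair (i : 'I_n) (A : 'M[R]_n) : nat * nat :=
  (nullity A, nullity (row' i (col' i A))).

Definition hadamard (A B : 'M[R]_n) : 'M[R]_n := map2_mx *%R A B.

Definition SNIP (i : 'I_n) (A : 'M[R]_n) : Prop :=
  forall X : 'M[R]_n, X^T = X ->
    hadamard A X = 0 -> hadamard 1%:M X = 0 -> row' i (A *m X) = 0 -> X = 0.

Definition allows_with_SNIP (G : sgraph 'I_n) (i : 'I_n) (k l : nat) : Prop :=
  exists A : 'M[R]_n, [/\ in_S G A, nullity_pair i A = (k, l) & SNIP i A].
End Matrices.

(* Main.v *)
(** All three conditions are equivalent to the following one, [obstructed]: the
    graph [G - i] has an edge that is not a bridge, or it has a vertex [b] of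
    degree at least 3 and a neighbour [j <> b] of [i] in the component of [b].

    Matrices.  If the nullity pair of [A] is (1,2), then the column [i] of [A] is
    not orthogonal to the kernel of [A(i)], and the [i]-SNIP says that [A(i)] has
    the strong Arnold property.  Hence the kernel lives on one component of
    [G - i] and is nonzero at some neighbour [j] of [i]; when [G] is not
    obstructed, a kernel vector vanishing at [j] vanishes along every branch
    leaving [j], contradicting nullity 2.  Conversely, suitable matrices are
    written down explicitly from graph Laplacians, whose kernels are known.

    Minors.  Obstruction lifts through each minor operation, and an obstructed
    connected graph has an evident minor model of the paw or of S(2,1,1). *)
From mathcomp Require Import all_boot all_order all_algebra.
From mathcomp Require Import reals boolp perm zify ring lra.
Require Import Defs.

Set Implicit Arguments.
Unset Strict Implicit.
Unset Printing Implicit Defensive.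

(** The pivot condition speaks of one relation on the full vertex set, so that it can be compared
    with minors, with trees and with kernels without passing to subgraph types. From matrices to
    graphs, the delicate point is the branch at [j] on which a kernel vector [w] with [w j = 0]
    lives: cutting [w] down to that branch keeps all kernel equations except possibly the one at
    [j]. Pairing with a kernel vector that is nonzero at [j] recovers the missing equation, which
    forces a zero at the first vertex of the branch. Two consecutive zeros then propagate, as all
    later degrees are at most 2. In the other direction, a kernel of dimension exactly 2 is wanted
    for a graph of unknown shape. A Laplacian is positive semidefinite, so its kernel follows from
    connectivity alone; a rank-one term, or the edges at one vertex, then adjusts the dimension to
    2. Bordering by a row not orthogonal to this kernel lowers the nullity to 1 and reduces the SNIP
    to the strong Arnold property. *)

Section Connect.
Variables (T : finType) (e : rel T).

Lemma connect_invariant (P : T -> Prop) x y :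
  (forall a b, P a -> e a b -> P b) -> connect e x y -> P x -> P y.
Proof.
move=> closedP /connectP[p + ->]; elim: p x => //= z p IHp x /andP[exz pz] Px.
exact: IHp pz (closedP _ _ Px exz).
Qed.

Lemma connect_exit (P : pred T) x y :
  connect e x y -> P x -> ~~ P y -> exists a b, [/\ P a, ~~ P b & e a b].
Proof.
move=> cxy Px nPy; apply: contrapT => nex.
have: P y; last by apply/negP.
apply: (connect_invariant (P := P)) cxy Px => a b Pa eab.
by apply: contrapT => /negP nPb; apply: nex; exists a, b.
Qed.

Lemma connect_first_step x y : connect e x y -> x != y -> exists z, e x z.
Proof.
move=> /connectP[[|z p] /= + ->]; first by rewrite eqxx.
by case/andP=> exz _ _; exists z.
Qed.

Lemma connect_map (T' : finType) (e' : rel T') (f : T -> T') x y :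
  (forall a b, e a b -> connect e' (f a) (f b)) -> connect e x y ->
  connect e' (f x) (f y).
Proof.
move=> fP cxy; apply: (connect_invariant (P := fun z => connect e' (f x) (f z))) cxy _.
  by move=> a b cxa /fP; apply: connect_trans.
exact: connect0.
Qed.

Lemma connectC x y : symmetric e -> connect e x y = connect e y x.
Proof. by move/sym_connect_sym; apply. Qed.

(** The vertex [j] is isolated rather than removed, so repeated deletions stay on one vertex
    type. *)
Definition avoid (j : T) : rel T := fun x y => [&& x != j, y != j & e x y].

Definition delete_edge (p q : T) : rel T :=
  fun x y => e x y && ~~ ((x == p) && (y == q) || (x == q) && (y == p)).

Definition nonbridge_edge := exists x y, e x y /\ connect (delete_edge x y) x y.

Definition cyclic_vertex :=
  exists j x y, [/\ x != y, e j x, e j y & connect (avoid j) x y].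

Lemma avoid_sym j : symmetric e -> symmetric (avoid j).
Proof. by move=> e_sym x y; rewrite /avoid e_sym andbCA. Qed.

Lemma avoid_irr j : irreflexive e -> irreflexive (avoid j).
Proof. by move=> e_irr x; rewrite /avoid e_irr !andbF. Qed.

Lemma avoid_sub j : subrel (avoid j) e.
Proof. by move=> x y /and3P[]. Qed.

Lemma delete_edge_sym p q : symmetric e -> symmetric (delete_edge p q).
Proof.
move=> e_sym x y; rewrite /delete_edge e_sym; congr (_ && ~~ _).
by rewrite orbC; congr (_ || _); rewrite andbC.
Qed.

Lemma delete_edge_sub p q : subrel (delete_edge p q) e.
Proof. by move=> x y /andP[]. Qed.

Lemma edge_neq x y : irreflexive e -> e x y -> x != y.
Proof. by move=> e_irr; apply: contraTneq => ->; rewrite e_irr. Qed.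

End Connect.

Lemma connect_avoid_neq (T : finType) (e : rel T) j x y : connect (avoid e j) x y -> x != j -> y != j.
Proof.
move=> c; apply: (connect_invariant (P := fun y => y != j)) c => a b _.
by case/and3P.
Qed.

(** The set reachable from [x] without passing through [y] can be left only by an edge into [y]; [z]
    is the last vertex before the first arrival. *)
Lemma first_hit (T : finType) (e : rel T) x y :
  connect e x y -> x != y -> exists z, [/\ z != y, connect (avoid e y) x z & e z y].
Proof.
move=> cxy nxy.
pose P z := (z != y) && connect (avoid e y) x z.
have [||a [b [/andP[nay cxa] nPb eab]]] := connect_exit (P := P) cxy.
- by rewrite /P nxy connect0.
- by rewrite /P eqxx.
exists a; split=> //.
case: (eqVneq b y) eab => [<- //|nby] eab; move: nPb; rewrite /P nby /=.
by rewrite (connect_trans cxa) // connect1 // /avoid nay nby.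
Qed.

(** * Cycles as non-bridge edges, as vertices with a bypass, and as cyclic sequences *)

Section Cycles.
Variables (T : finType) (e : rel T).
Hypotheses (e_sym : symmetric e) (e_irr : irreflexive e).

Lemma cyclic_vertex_nonbridge : cyclic_vertex e -> nonbridge_edge e.
Proof.
move=> [j [x [y [nxy ejx ejy cxy]]]]; exists x, j; rewrite e_sym; split=> //.
apply: connect_trans (_ : connect _ x y) (connect1 _).
  apply: connect_sub cxy => a b /and3P[naj nbj eab].
  by apply: connect1; rewrite /delete_edge eab (negPf naj) (negPf nbj) andbF.
rewrite /delete_edge e_sym ejy eqxx andbT eq_sym (negPf nxy) /=.
by rewrite [j == x](negPf (edge_neq e_irr ejx)) andbF.
Qed.

(** On the bypass, the last vertex before [y] is not [x], since the edge between them is deleted; so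
    [y] has two neighbours joined off [y]. *)
Lemma nonbridge_cyclic_vertex : nonbridge_edge e -> cyclic_vertex e.
Proof.
move=> [x [y [exy cxy]]].
have [z [nzy cxz dzy]] := first_hit cxy (edge_neq e_irr exy).
have ezy := delete_edge_sub dzy; exists y, x, z; split.
- by apply: contraTneq dzy => <-; rewrite /delete_edge !eqxx andbF.
- by rewrite e_sym.
- by rewrite e_sym.
apply: connect_sub cxz => a b /and3P[nay nby /delete_edge_sub eab].
by apply: connect1; rewrite /avoid nay nby.
Qed.

Lemma cyclic_vertex_ucycle :
  cyclic_vertex e -> exists s : seq T, 2 < size s /\ ucycle e s.
Proof.
move=> [j [x [y [nxy ejx ejy /connectP[p pp Ey]]]]].
case/shortenP: pp Ey => p' pp' up' _ Ey.
have path_e : path e x p' by apply: sub_path pp'; apply: avoid_sub.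
exists (j :: x :: p'); split.
  by case: p' Ey {pp' up' path_e} => //= Ey; rewrite Ey eqxx in nxy.
rewrite /ucycle /= ejx rcons_path path_e -Ey e_sym ejy /=.
move: up' => /= ->; rewrite andbT.
apply/negP => jp; have nxj : x != j by rewrite eq_sym (edge_neq e_irr).
move: jp; rewrite inE eq_sym (negPf nxj) /= => jp.
by elim: p' x pp' jp {nxy ejx Ey path_e nxj} => //= z p' IH x /andP[/and3P[_ nzj _] /IH pp'];
  rewrite inE eq_sym (negPf nzj).
Qed.

Lemma ucycle_cyclic_vertex (s : seq T) : 2 < size s -> ucycle e s -> cyclic_vertex e.
Proof.
case: s => [//|j [//|x [//|z p]]] _ /andP[/= /and3P[ejx exz +] /and3P[]].
rewrite rcons_path => /andP[pz elj] jxzp xzp uzp.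
exists j, x, (last z p); split=> //; last 2 first.
- by rewrite e_sym.
- apply/connectP; exists (z :: p) => //.
  have: path e x (z :: p) by rewrite /= exz.
  elim: (z :: p) x jxzp {exz ejx xzp uzp pz elj} => //= a q IH x.
  rewrite !inE !negb_or => /and3P[njx nja njq] /andP[exa paq].
  rewrite /avoid exa eq_sym njx eq_sym nja /=; apply: IH => //.
  by rewrite inE negb_or nja.
by apply: contraNneq xzp => ->; apply: mem_last.
Qed.

End Cycles.

(** * The common obstruction *)

Definition unrooted_adj (H : rgraph) : rel (vertex H) := avoid (adj (graph H)) (root H).

Lemma unrooted_sym H : symmetric (@unrooted_adj H).
Proof. exact/avoid_sym/adj_sym. Qed.

Lemma unrooted_irr H : irreflexive (@unrooted_adj H).
Proof. exact/avoid_irr/adj_irr. Qed.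

(** The alternatives mirror the triangle of the paw and the vertex of degree 3 of S(2,1,1). In the
    first one, connectedness of the graph supplies the attachment to the root. *)
Definition obstructed (H : rgraph) : Prop :=
  nonbridge_edge (@unrooted_adj H) \/
  exists j b : vertex H,
    [/\ adj (graph H) (root H) j, j != b, connect (@unrooted_adj H) j b &
        2 < #|[set y | unrooted_adj b y]|].

Lemma set2_eq (T : finType) (x y u v : T) :
  ([set x; y] == [set u; v]) = (x == u) && (y == v) || (x == v) && (y == u).
Proof.
apply/eqP/idP => [E|/orP[]/andP[/eqP-> /eqP->] //]; last exact: setUC.
have: x \in [set u; v] by rewrite -E set21.
have: y \in [set u; v] by rewrite -E set22.
have: u \in [set x; y] by rewrite E set21.
have: v \in [set x; y] by rewrite E set22.
rewrite !inE [u == x]eq_sym [u == y]eq_sym [v == x]eq_sym [v == y]eq_sym.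
by do 4!case: (_ == _).
Qed.

(** * Rooted minors from minor models *)

(* Fibres of [phi] are the branch sets, each connected to its centre [r q]. *)
Definition minor_model (Q H : rgraph) (phi : vertex H -> vertex Q) (r : vertex Q -> vertex H) :=
  [/\ phi (root H) = root Q, cancel r phi,
      forall x, connect (fun a b => adj (graph H) a b && (phi a == phi b)) (r (phi x)) x &
      forall p q, adj (graph Q) p q ->
        exists x y, [/\ phi x = p, phi y = q & adj (graph H) x y]].

Section Contraction.
Variables (H : rgraph) (u v : vertex H).
Hypothesis uv : adj (graph H) u v.

Lemma contraction_neq : u != v.
Proof. exact: (edge_neq (@adj_irr _ _)) uv. Qed.

Let V := {w : vertex H | w != v}.

(** The vertices other than [v] represent the quotient; [insubd] sends [v], the only vertex outside
    [V], to its default [u]. *)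
Definition contraction_map (w : vertex H) : V := insubd (Sub u contraction_neq : V) w.

Lemma val_contraction_map w : val (contraction_map w) = if w != v then w else u.
Proof. exact: val_insubd. Qed.

Definition contraction_adj : rel V := fun p q =>
  (p != q) && [exists x, exists y,
    [&& contraction_map x == p, contraction_map y == q & adj (graph H) x y]].

Lemma contraction_sym : symmetric contraction_adj.
Proof.
move=> p q; rewrite /contraction_adj eq_sym; congr (_ && _).
apply/existsP/existsP => -[x /existsP[y /and3P[xp yq xy]]];
  by exists y; apply/existsP; exists x; rewrite xp yq adj_sym.
Qed.

Lemma contraction_irr : irreflexive contraction_adj.
Proof. by move=> p; rewrite /contraction_adj eqxx. Qed.

Definition contraction : rgraph :=
  RGraph (SGraph contraction_sym contraction_irr) (contraction_map (root H)).

Lemma contraction_map_eq x y :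
  contraction_map x = contraction_map y <-> x = y \/ [set x; y] = [set u; v].
Proof.
have nuv := contraction_neq; split=> [/(congr1 val)|].
  rewrite !val_contraction_map.
  case: (eqVneq x v) => [->|nx]; case: (eqVneq y v) => [->|ny] /= E; try by left.
    by right; rewrite E setUC.
  by right; rewrite E.
case=> [->//|/eqP]; rewrite set2_eq => /orP[]/andP[/eqP-> /eqP->];
  by apply: val_inj; rewrite !val_contraction_map eqxx nuv.
Qed.

Lemma contraction_edge x y : adj (graph H) x y -> contraction_map x != contraction_map y ->
  contraction_adj (contraction_map x) (contraction_map y).
Proof.
move=> xy nxy; rewrite /contraction_adj nxy; apply/existsP; exists x.
by apply/existsP; exists y; rewrite !eqxx.
Qed.

Lemma edge_contractionP : edge_contraction H contraction.
Proof.
exists u, v, contraction_map; split=> //.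
  split; last exact: contraction_map_eq.
  by case=> w nw; exists w; apply: val_inj; rewrite val_contraction_map /= nw.
move=> p q; split.
  case/andP=> npq /existsP[x /existsP[y /and3P[/eqP xp /eqP yq xy]]].
  by split; [apply/eqP | exists x, y].
move=> [/eqP npq [x [y [xp yq xy]]]].
by rewrite -xp -yq in npq *; apply: contraction_edge.
Qed.

(** As [phi] is constant on the contracted pair, it descends to the quotient, and branch sets stay
    connected there. *)
Lemma contraction_model (Q : rgraph) (phi : vertex H -> vertex Q) r :
  phi u = phi v -> minor_model phi r ->
  minor_model (H := contraction) (fun w => phi (val w)) (fun q => contraction_map (r q)).
Proof.
move=> phi_uv [phi_root rK fib edges].
have phi_f w : phi (val (contraction_map w)) = phi w.
  by rewrite val_contraction_map; case: eqVneq => [->|].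
have f_val (w : V) : contraction_map (val w) = w.
  by apply: val_inj; rewrite val_contraction_map (valP w).
split=> /= [|q|w|p q pq].
- by rewrite phi_f.
- by rewrite phi_f rK.
- rewrite -{2}[w]f_val; apply: connect_map (fib (val w)) => a b /andP[ab phi_ab].
  case: (eqVneq (contraction_map a) (contraction_map b)) => [->|nab]; first exact: connect0.
  by apply: connect1; rewrite !phi_f phi_ab andbT; apply: contraction_edge.
- have [x [y [xp yq xy]]] := edges p q pq.
  exists (contraction_map x), (contraction_map y); rewrite !phi_f; split=> //.
  apply: contraction_edge => //; apply: contraTneq pq => /(congr1 (phi \o val)) /=.
  by rewrite !phi_f xp yq => ->; rewrite adj_irr.
Qed.

End Contraction.

Section EdgeRemoval.
Variables (H : rgraph) (u v : vertex H).

Lemma delete_edge_irr : irreflexive (delete_edge (adj (graph H)) u v).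
Proof. by move=> x; rewrite /delete_edge adj_irr. Qed.

Definition edge_removal : rgraph :=
  RGraph (SGraph (delete_edge_sym u v (@adj_sym _ (graph H))) delete_edge_irr) (root H).

Lemma edge_deletionP : adj (graph H) u v -> edge_deletion H edge_removal.
Proof.
move=> uv; exists u, v, id; split=> // [|x y]; first by exists id.
by rewrite set2_eq.
Qed.

End EdgeRemoval.

(** Induction on the number of edges of [H] without counterpart in [Q]. Deleting one of them keeps
    the model: branch sets are single vertices, and no edge of [Q] is realised by it. *)
Lemma injective_model_minor (Q H : rgraph) (phi : vertex H -> vertex Q) r :
  injective phi -> minor_model phi r -> rooted_minor Q H.
Proof.
have [m] := ubnP #|[set xy | adj (graph H) xy.1 xy.2 && ~~ adj (graph Q) (phi xy.1) (phi xy.2)]|.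
elim: m H phi r => // m IHm H phi r lem phi_inj model; case: (model) => phi_root rK fib edges.
have [extra|none] := pickP (fun xy => adj (graph H) xy.1 xy.2 && ~~ adj (graph Q) (phi xy.1) (phi xy.2)).
  case: extra => u v /= /andP[uv nuv].
  apply: minor_edge_deletion (edge_deletionP uv) _.
  apply: (IHm (edge_removal u v) phi r) => //.
    move: lem; rewrite ltnS; apply: leq_trans; apply: proper_card.
    apply/properP; split.
      by apply/subsetP => -[x y]; rewrite !inE /= => /andP[/delete_edge_sub-> ->].
    by exists (u, v); rewrite !inE /= ?uv ?nuv // /delete_edge !eqxx andbF.
  split=> // [x|p q pq].
    by rewrite (phi_inj _ _ (rK (phi x))) connect0.
  have [x [y [xp yq xy]]] := edges p q pq; exists x, y; split=> //=.
  rewrite /delete_edge xy /=; apply: contraNN nuv.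
  by case/orP=> /andP[/eqP<- /eqP<-]; rewrite xp yq ?[adj _ q p]adj_sym.
apply: minor_iso; exists phi; split=> // [|x y].
  by exists r => // x; apply: phi_inj; rewrite rK.
apply/idP/idP => [pq|xy]; last by have := none (x, y); rewrite /= xy /= => /negbFE.
by have [x' [y' [/phi_inj-> /phi_inj->]]] := edges _ _ pq.
Qed.

(** The branch sets cover [H]. One with two vertices is connected and so contains an edge, whose
    contraction leaves fewer vertices; once all are singletons, edge deletions suffice. *)
Lemma minor_model_minor (Q H : rgraph) (phi : vertex H -> vertex Q) r :
  minor_model phi r -> rooted_minor Q H.
Proof.
have [m] := ubnP #|vertex H|.
elim: m H phi r => // m IHm H phi r lem model; case: (model) => phi_root rK fib edges.
have [phi_inj|] := pselect (injective phi); first exact: injective_model_minor model.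
move=> /existsNP[x /existsNP[y /not_implyP[phi_xy /eqP nxy]]].
have [u [v [uv phi_uv]]] : exists u v, adj (graph H) u v /\ phi u = phi v.
  (* Of two vertices in one fibre, at least one is not the centre. *)
  wlog nrx : x y phi_xy nxy / r (phi x) != x.
    move=> W; case: (eqVneq (r (phi x)) x) => [rx|]; last exact: (W x y).
    by apply: (W y x); rewrite -?phi_xy ?rx // eq_sym.
  have [z /andP[rz /eqP phi_rz]] := connect_first_step (fib x) nrx.
  by exists (r (phi x)), z.
apply: minor_edge_contraction (edge_contractionP uv) _.
apply: IHm (contraction_model uv phi_uv model).
rewrite card_sig; move: lem; rewrite ltnS; apply: leq_trans.
rewrite [leqRHS](cardD1 v) /= add1n ltnS; apply/subset_leq_card/subsetP => w.
by rewrite !inE andbT.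
Qed.

Section PartialModel.
Variables (Q H : rgraph) (r : vertex Q -> vertex H).
Hypothesis H_connected : connected_graph (graph H).

Let fibre_adj (phi : vertex H -> option (vertex Q)) : rel (vertex H) :=
  fun a b => [&& adj (graph H) a b, phi a == phi b & phi a != None].

(* In a connected graph, vertices outside the branch sets can be absorbed one at
   a time by a neighbouring branch set. *)
Lemma extend_partial_model (phi : vertex H -> option (vertex Q)) :
  phi (root H) = Some (root Q) -> (forall q, phi (r q) = Some q) ->
  (forall q x, phi x = Some q -> connect (fibre_adj phi) (r q) x) ->
  (forall p q, adj (graph Q) p q ->
     exists x y, [/\ phi x = Some p, phi y = Some q & adj (graph H) x y]) ->
  exists psi : vertex H -> vertex Q, minor_model psi r.
Proof.
have [m] := ubnP #|[set x | phi x == None]|.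
elim: m phi => // m IHm phi lem phi_rt phi_r fib edges.
have [z0 /eqP z0N|allS] := pickP (fun x => phi x == None); last first.
  pose psi x := odflt (root Q) (phi x).
  have psiE x : phi x = Some (psi x) by rewrite /psi; case: (phi x) (allS x).
  exists psi; split=> [|q|x|p q pq].
  - by rewrite /psi phi_rt.
  - by rewrite /psi phi_r.
  - apply: connect_sub (fib _ _ (psiE x)) => a b /and3P[ab phi_ab _].
    by apply: connect1; rewrite ab -(inj_eq (@Some_inj _)) -!psiE.
  - have [x [y [xp yq xy]]] := edges p q pq; exists x, y.
    by split=> //; apply: Some_inj; rewrite -psiE.
have [||y [z [+ + yz]]] :=
  connect_exit (P := fun x => phi x != None) (H_connected (root H) z0).
- by rewrite phi_rt.
- by rewrite z0N.
case E: (phi y) => [q|//] _; rewrite negbK => /eqP zN.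
pose phi' x := if x == z then Some q else phi x.
have phi'E x : phi x != None -> phi' x = phi x.
  by rewrite /phi'; case: (eqVneq x z) => // ->; rewrite zN.
have phi'S x p : phi x = Some p -> phi' x = Some p by move=> xp; rewrite phi'E xp.
have fib' p x : phi x = Some p -> connect (fibre_adj phi') (r p) x.
  move/fib; apply: connect_sub => a b /and3P[ab /eqP phi_ab aN]; apply: connect1.
  by rewrite /fibre_adj ab !phi'E -?phi_ab // eqxx.
apply: (IHm phi').
- move: lem; rewrite ltnS; apply: leq_trans; apply: proper_card; apply/properP; split.
    by apply/subsetP => x; rewrite !inE /phi'; case: (x == z).
  by exists z; rewrite !inE ?zN // /phi' eqxx.
- exact: phi'S.
- by move=> p; apply: phi'S.
- move=> p x; rewrite {1}/phi'; case: (eqVneq x z) => [-> [<-]|_ /fib' //].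
  apply: connect_trans (fib' _ _ E) (connect1 _).
  by rewrite /fibre_adj yz (phi'S _ _ E) /phi' !eqxx.
- move=> p q' pq; have [x [y' [xp yq xy]]] := edges p q' pq.
  by exists x, y'; split=> //; apply: phi'S.
Qed.

End PartialModel.

(** A reachable set is connected inside itself, which is what makes it usable as a branch set. *)
Lemma connect_within (T : finType) (e : rel T) x y : connect e x y ->
  connect (fun a b => [&& e a b, connect e x a & connect e x b]) x y.
Proof.
set R := fun _ _ => _ => cxy.
suff [] : connect R x y /\ connect e x y by [].
apply: (connect_invariant (P := fun z => connect R x z /\ connect e x z)) cxy _ => //.
move=> a b [Rxa exa] eab; have exb := connect_trans exa (connect1 eab).
by split=> //; apply: connect_trans Rxa (connect1 _); rewrite /R eab exa.
Qed.

Lemma edge_list_edges n E (H : rgraph) (phi : vertex H -> option 'I_n) :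
  (forall p q : 'I_n, (val p, val q) \in E ->
     exists x y, [/\ phi x = Some p, phi y = Some q & adj (graph H) x y]) ->
  forall p q, adj (edge_list_graph n E) p q ->
    exists x y, [/\ phi x = Some p, phi y = Some q & adj (graph H) x y].
Proof.
move=> edges p q /andP[_ /orP[/edges//|/edges[x [y [xq yp xy]]]]].
by exists y, x; rewrite adj_sym.
Qed.

(** * Minor models of the paw and of S(2,1,1) in obstructed graphs *)

Section ObstructedMinor.
Variable H : rgraph.
Hypothesis H_connected : connected_graph (graph H).
Let V := vertex H.
Let i : V := root H.
Let e : rel V := @unrooted_adj H.

Let e_sym : symmetric e := @unrooted_sym H.
Let e_irr : irreflexive e := @unrooted_irr H.
Let e_adj x y : e x y -> adj (graph H) x y := @avoid_sub _ _ _ x y.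

(** The paw without its edge at the root: which corner the root attaches to is known only once the
    branch sets cover the graph. *)
Definition rooted_triangle : rgraph :=
  RGraph (edge_list_graph 4 [:: (1, 2); (1, 3); (2, 3)]) ord0.

Lemma triangle_model : cyclic_vertex e ->
  exists (phi : V -> 'I_4) r, minor_model (Q := rooted_triangle) (H := H) phi r.
Proof.
move=> [j [x [y [nxy ejx ejy cxy]]]].
have [ni_j ni_x _] := and3P ejx; have [_ ni_y _] := and3P ejy.
have njx := edge_neq e_irr ejx; have njy := edge_neq e_irr ejy.
have cyx : connect (avoid e j) y x by rewrite connectC //; apply: avoid_sym.
have [|z [nzx cyz zx]] := first_hit cyx; first by rewrite eq_sym.
(* The corners are [j], [x] and the set reachable from [y] off both; [z] is where this set touches
   [x]. *)
pose R := avoid (avoid e j) x.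
pose phi w : option 'I_4 :=
  if w == i then Some (inord 0) else if w == j then Some (inord 1) else
  if w == x then Some (inord 2) else if connect R y w then Some (inord 3) else None.
have phi_i : phi i = Some (inord 0) by rewrite /phi eqxx.
have phi_j : phi j = Some (inord 1) by rewrite /phi (negPf ni_j) eqxx.
have phi_x : phi x = Some (inord 2).
  by rewrite /phi (negPf ni_x) eq_sym (negPf njx) eqxx.
have phi_S w : connect R y w -> phi w = Some (inord 3).
  move=> cw; have nwx : w != x by apply: connect_avoid_neq cw _; rewrite eq_sym.
  have cjw : connect (avoid e j) y w by apply: connect_sub cw => a b /avoid_sub; apply: connect1.
  have nwj : w != j by apply: connect_avoid_neq cjw _; rewrite eq_sym.
  have ciw : connect e y w by apply: connect_sub cjw => a b /avoid_sub; apply: connect1.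
  by rewrite /phi (negPf (connect_avoid_neq ciw ni_y)) (negPf nwj) (negPf nwx) cw.
pose r (q : 'I_4) := nth i [:: i; j; x; y] q.
suff [psi model] : exists psi : V -> 'I_4, minor_model (Q := rooted_triangle) (H := H) psi r.
  by exists psi, r.
apply: (@extend_partial_model rooted_triangle H r H_connected phi).
- by rewrite phi_i; congr Some; apply: val_inj; rewrite /= inordK.
- move=> q; rewrite -[in RHS](inord_val q) /r.
  by case: (val q) (ltn_ord q) => [|[|[|[|]]]] //= _; apply: phi_S; apply: connect0.
- move=> q w phi_w; rewrite -(inord_val q) in phi_w *; rewrite /r inordK //.
  move: phi_w; rewrite {1}/phi.
  case: eqVneq => [-> [/(congr1 val)]|_]; first by rewrite /= !inordK // => <-; apply: connect0.
  case: eqVneq => [-> [/(congr1 val)]|_]; first by rewrite /= !inordK // => <-; apply: connect0.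
  case: eqVneq => [-> [/(congr1 val)]|_]; first by rewrite /= !inordK // => <-; apply: connect0.
  case: ifP => // cw [/(congr1 val)]; rewrite /= !inordK // => <- /=.
  apply: connect_sub (connect_within cw) => a b /and3P[ab ca cb]; apply: connect1.
  rewrite !phi_S // eqxx /= andbT; apply: e_adj; exact: avoid_sub (avoid_sub ab).
- apply: edge_list_edges => p q; rewrite !inE => /or3P[]/eqP[Ep Eq];
    rewrite -(inord_val p) -(inord_val q) Ep Eq.
  + by exists j, x; rewrite e_adj.
  + by exists j, y; rewrite e_adj // (phi_S y).
  + by exists x, z; rewrite adj_sym e_adj ?(avoid_sub zx) // (phi_S z).
Qed.

Lemma cyclic_Paw : cyclic_vertex e -> rooted_minor Paw H.
Proof.
move=> /triangle_model[phi [r [phi_i rK fib edges]]].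
have phi_i0 : phi i = 0 :> nat by rewrite phi_i.
have [||u [v [u0 v0 uv]]] := connect_exit (P := fun w => phi w == 0 :> nat)
  (H_connected i (r (inord 1))).
- by rewrite phi_i0.
- by rewrite rK inordK.
(* The edge from [u] to [v] leaves the branch set of the root. All corners being adjacent, the label
   of [v] may be swapped with 1, the neighbour of the root in the paw; 0 is fixed. *)
pose s : 'I_4 -> 'I_4 := tperm (inord 1) (phi v).
have sK : involutive s by move=> q; rewrite /s tpermK.
have s0 q : (s q == 0 :> nat) = (q == 0 :> nat).
  rewrite /s; case: tpermP => [->|->|//]; first by rewrite inordK // (negPf v0).
  by rewrite inordK // (negPf v0).
apply: (@minor_model_minor _ _ (s \o phi : V -> vertex Paw) (r \o s)); split.
- by apply: val_inj; apply/eqP; rewrite /= s0 phi_i0.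
- by move=> q /=; rewrite rK sK.
- move=> x /=; rewrite sK; apply: connect_sub (fib x) => a b /andP[ab /eqP phi_ab].
  by apply: connect1; rewrite ab /= phi_ab eqxx.
move=> p q pq; have npq : p != q by case/andP: pq.
have [/andP[p0 q0]|] := boolP ((p != 0 :> nat) && (q != 0 :> nat)).
  have [|x [y [xp yq xy]]] := edges (s p) (s q); last first.
    by exists x, y; rewrite /= xp yq !sK.
  have := s0 p; have := s0 q; have : s p != s q by rewrite (inj_eq (inv_inj sK)).
  rewrite (negPf p0) (negPf q0).
  by case: (s p) => -[|[|[|[|//]]]] ? ; case: (s q) => -[|[|[|[|//]]]] ?.
have Paw0 (a b : 'I_4) : a = 0 :> nat -> adj (graph Paw) a b -> b = inord 1.
  move=> a0 /andP[_]; rewrite /= a0 !inE => ab; apply: val_inj; rewrite /= inordK //.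
  by apply/eqP; case: (val b) ab => [|[|[|[|]]]].
have su : s (phi u) = 0 :> nat by apply/eqP; rewrite s0.
have sv : s (phi v) = inord 1 by rewrite /s tpermR.
rewrite negb_and !negbK => /orP[]/eqP c0.
  exists u, v; split=> //; last by rewrite (Paw0 p q).
  by apply: val_inj; rewrite /= su.
exists v, u; split=> /=; rewrite ?[adj _ v u]adj_sym //.
  by rewrite (Paw0 q p) // adj_sym.
by apply: val_inj; rewrite /= su.
Qed.

Lemma branching_S211 j b : ~ cyclic_vertex e ->
  adj (graph H) i j -> j != b -> connect e j b -> 2 < #|[set y | e b y]| ->
  rooted_minor S211 H.
Proof.
move=> acyclic ij njb cjb degb.
have nji : j != i by rewrite eq_sym (edge_neq (@adj_irr _ _) ij).
have nbi : b != i by apply: connect_avoid_neq cjb nji.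
pose A := [set w | connect (avoid e b) j w].
have [a [nab cja eab]] := first_hit cjb njb.
(* Two neighbours of [b] in the part containing [j] would put [b] on a cycle. Hence two neighbours
   of [b] lie outside [A] and can serve as the leaves. *)
have A1 : #|[set y | e b y] :&: A| <= 1.
  rewrite leqNgt; apply/negP => /card_gt1P[x [y [/setIP[+ +] /setIP[+ +] nxy]]].
  rewrite !inE => ebx cjx eby cjy; apply: acyclic; exists b, x, y; split=> //.
  by apply: connect_trans cjy; rewrite connectC //; apply: avoid_sym.
have : 1 < #|[set y | e b y] :\: A|.
  by rewrite cardsD ltn_subRL; apply: leq_ltn_trans degb; rewrite addn1 ltnS.
move=> /card_gt1P[c [d [/setDP[+ +] /setDP[+ +] ncd]]]; rewrite !inE => ebc nAc ebd nAd.
have [_ nci _] := and3P ebc; have [_ ndi _] := and3P ebd.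
have nbc := edge_neq e_irr ebc; have nbd := edge_neq e_irr ebd.
pose phi w : option 'I_5 :=
  if w == i then Some (inord 0) else if w == b then Some (inord 2) else
  if connect (avoid e b) j w then Some (inord 1) else
  if w == c then Some (inord 3) else if w == d then Some (inord 4) else None.
have phi_i : phi i = Some (inord 0) by rewrite /phi eqxx.
have phi_b : phi b = Some (inord 2) by rewrite /phi (negPf nbi) eqxx.
have phi_A w : connect (avoid e b) j w -> phi w = Some (inord 1).
  move=> cw; have nwb := connect_avoid_neq cw njb.
  have ciw : connect e j w by apply: connect_sub cw => x y /avoid_sub; apply: connect1.
  by rewrite /phi (negPf (connect_avoid_neq ciw nji)) (negPf nwb) cw.
have phi_c : phi c = Some (inord 3).
  by rewrite /phi (negPf nci) eq_sym (negPf nbc) (negPf nAc) eqxx.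
have phi_d : phi d = Some (inord 4).
  by rewrite /phi (negPf ndi) eq_sym (negPf nbd) (negPf nAd) eq_sym (negPf ncd) eqxx.
pose r (q : 'I_5) := nth i [:: i; j; b; c; d] q.
suff [psi model] : exists psi : V -> 'I_5, minor_model (Q := S211) (H := H) psi r.
  exact: minor_model_minor model.
apply: (@extend_partial_model S211 H r H_connected phi).
- by rewrite phi_i; congr Some; apply: val_inj; rewrite /= inordK.
- move=> q; rewrite -[in RHS](inord_val q) /r.
  by case: (val q) (ltn_ord q) => [|[|[|[|[|]]]]] //= _; apply: phi_A; apply: connect0.
- move=> q w phi_w; rewrite -(inord_val q) in phi_w *; rewrite /r inordK //.
  move: phi_w; rewrite {1}/phi.
  case: eqVneq => [-> [/(congr1 val)]|_]; first by rewrite /= !inordK // => <-; apply: connect0.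
  case: eqVneq => [-> [/(congr1 val)]|_]; first by rewrite /= !inordK // => <-; apply: connect0.
  case: ifP => [cw [/(congr1 val)]|_].
    rewrite /= !inordK // => <- /=.
    apply: connect_sub (connect_within cw) => x y /and3P[xy cx cy]; apply: connect1.
    by rewrite !phi_A // eqxx /= andbT; apply: e_adj; apply: avoid_sub xy.
  case: eqVneq => [-> [/(congr1 val)]|_]; first by rewrite /= !inordK // => <-; apply: connect0.
  by case: eqVneq => [-> [/(congr1 val)]|_ //]; rewrite /= !inordK // => <-; apply: connect0.
- apply: edge_list_edges => p q; rewrite !inE => /or4P[]/eqP[Ep Eq];
    rewrite -(inord_val p) -(inord_val q) Ep Eq.
  + by exists i, j; rewrite (phi_A j).
  + by exists a, b; rewrite e_adj // (phi_A a).
  + by exists b, c; rewrite e_adj.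
  + by exists b, d; rewrite e_adj.
Qed.

Lemma obstructed_minor : obstructed H -> rooted_minor Paw H \/ rooted_minor S211 H.
Proof.
have [cyc _|acyclic] := pselect (cyclic_vertex e); first by left; apply: cyclic_Paw.
case=> [/(nonbridge_cyclic_vertex e_sym e_irr)//|[j [b [ij njb cjb degb]]]].
by right; apply: branching_S211 acyclic ij njb cjb degb.
Qed.

End ObstructedMinor.

(** * Lifting the obstruction through the minor operations *)

Lemma obstructed_injective (H H' : rgraph) (g : vertex H' -> vertex H) :
  injective g -> g (root H') = root H ->
  (forall x y, adj (graph H') x y -> adj (graph H) (g x) (g y)) ->
  obstructed H' -> obstructed H.
Proof.
move=> g_inj g_root g_adj.
have g_e x y : unrooted_adj x y -> unrooted_adj (g x) (g y).
  by rewrite /unrooted_adj /avoid -g_root !(inj_eq g_inj) => /and3P[-> -> /g_adj].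
case=> [[x [y [xy cxy]]]|[j [b [ij njb cjb degb]]]].
  left; exists (g x), (g y); split; first exact: g_e.
  apply: connect_map cxy => a b /andP[/g_e ab nab]; apply: connect1.
  by rewrite /delete_edge ab !(inj_eq g_inj).
right; exists (g j), (g b); split.
- by rewrite -g_root g_adj.
- by rewrite (inj_eq g_inj).
- by apply: connect_map cjb => x y /g_e; apply: connect1.
apply: leq_trans degb _; rewrite -(card_imset _ g_inj); apply/subset_leq_card/subsetP.
by move=> _ /imsetP[y + ->]; rewrite !inE => /g_e.
Qed.

Section ContractionObstructed.
Variables (H H' : rgraph) (u v : vertex H) (f : vertex H -> vertex H').
Hypotheses (uv : adj (graph H) u v)
  (f_eq : forall x y, f x = f y <-> x = y \/ [set x; y] = [set u; v])
  (f_root : f (root H) = root H')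
  (f_adj : forall p q, adj (graph H') p q <->
     p <> q /\ exists x y, [/\ f x = p, f y = q & adj (graph H) x y]).

Let e : rel (vertex H) := @unrooted_adj H.
Let e' : rel (vertex H') := @unrooted_adj H'.
Let e_sym : symmetric e := @unrooted_sym H.

Lemma lift_edge p q : e' p q -> exists x y, [/\ f x = p, f y = q & e x y].
Proof.
move=> /and3P[np nq /f_adj[_ [x [y [xp yq xy]]]]]; exists x, y; split=> //.
rewrite /e /unrooted_adj /avoid xy andbT; apply/andP; split.
  by apply: contraNneq np => xi; rewrite -xp xi f_root.
by apply: contraNneq nq => yi; rewrite -yq yi f_root.
Qed.

Lemma contraction_fibre x y : f x = f y -> x != y ->
  (x == u) && (y == v) || (x == v) && (y == u).
Proof. by move=> /f_eq[->|/eqP]; rewrite ?eqxx // set2_eq. Qed.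

Lemma fibre_edge x y : f x = f y -> x != y -> f x != root H' -> e x y.
Proof.
move=> fxy nxy nfx; have nfy : f y != root H' by rewrite -fxy.
have nx z : f z != root H' -> z != root H by apply: contraNneq => ->; rewrite f_root.
rewrite /e /unrooted_adj /avoid !nx //=.
by case/orP: (contraction_fibre fxy nxy) => /andP[/eqP-> /eqP->] //; rewrite adj_sym.
Qed.

(** A walk lifts edge by edge; where one lifted edge ends and the next begins, both points share a
    fibre and are joined inside it. The root of [H'] is excluded because its fibre contains the root
    of [H], which is isolated in [G - i]. *)
Lemma lift_connect (R : rel (vertex H)) (R' : rel (vertex H')) x y :
  (forall p q, R' p q -> exists a b, [/\ f a = p, f b = q & R a b]) ->
  (forall a b, f a = f b -> f a != root H' -> connect R a b) ->
  (forall p q, R' p q -> q != root H') ->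
  f x != root H' -> connect R' (f x) (f y) -> connect R x y.
Proof.
move=> liftR fibR R'root nfx cxy.
pose P p := p != root H' /\ forall z, f z = p -> connect R x z.
suff [_ ->//] : P (f y).
apply: (connect_invariant (P := P)) cxy _; last first.
  by split=> // z fz; apply: fibR; rewrite ?fz.
move=> p q [np cxp] R'pq; split; first exact: R'root R'pq.
move=> z fz; have [a [b [ap bq Rab]]] := liftR p q R'pq.
apply: connect_trans (cxp _ ap) (connect_trans (connect1 Rab) _).
by apply: fibR; rewrite bq ?fz //; apply: R'root R'pq.
Qed.

Lemma lift_connect_unrooted x y : f x != root H' -> connect e' (f x) (f y) -> connect e x y.
Proof.
apply: lift_connect; [exact: lift_edge | | by move=> p q /and3P[]].
move=> a b fab nfa; case: (eqVneq a b) => [->|nab]; first exact: connect0.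
exact/connect1/fibre_edge.
Qed.

(** The three neighbours may hang on different ends of the contracted edge; if [x] and [z] differ,
    then [z] replaces [y3] as the third neighbour of [x]. *)
Lemma lift_degree x z y1 y2 y3 : f x = f z -> f x != root H' ->
  e x y1 -> e x y2 -> e z y3 -> f y1 != f y2 -> f y2 != f y3 -> f y3 != f y1 ->
  f y1 != f x -> f y2 != f x -> 2 < #|[set y | e x y]|.
Proof.
move=> fxz nfx xy1 xy2 zy3 n12 n23 n31 n1 n2.
have nf a b : f a != f b -> a != b by apply: contraNneq => ->.
apply/card_gt2P; case: (eqVneq x z) zy3 => [<-|nxz] zy3.
  by exists y1, y2, y3; rewrite !inE; split; split; rewrite ?nf.
exists y1, y2, z; rewrite !inE; split; split; rewrite ?nf -?fxz // 1?eq_sym //.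
exact: fibre_edge.
Qed.

Lemma contraction_obstructed : obstructed H' -> obstructed H.
Proof.
case=> [[p [q [pq cpq]]]|[j' [b' [ij' njb' cjb' degb']]]].
  have [x [y [xp yq xy]]] := lift_edge pq.
  have [np nq _] := and3P pq; have npq := edge_neq (@unrooted_irr H') pq.
  left; exists x, y; split=> //.
  apply: lift_connect (_ : connect (delete_edge e' p q) (f x) (f y)); rewrite ?xp ?yq //.
  - move=> c d /andP[/lift_edge[a [b [ac bd ab]]] nab]; exists a, b; split=> //.
    rewrite /delete_edge -/e ab /=; apply: contraNN nab; rewrite -ac -bd -xp -yq.
    by case/orP=> /andP[/eqP-> /eqP->]; rewrite !eqxx ?orbT.
  - move=> a b fab nfa; case: (eqVneq a b) => [->|nab]; first exact: connect0.
    apply: connect1; rewrite /delete_edge -/e (fibre_edge fab nab nfa) /=.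
    by apply: contraNN npq; rewrite -xp -yq => /orP[]/andP[/eqP<- /eqP<-]; rewrite fab.
  - by move=> c d /andP[/and3P[]].
move/card_gt2P: degb' => [s1 [s2 [s3 [[]]]]]; rewrite !inE -/e' => bs1 bs2 bs3 [n12 n23 n31].
have [nb' _ _] := and3P bs1.
have nsb s : e' b' s -> s != b' by rewrite eq_sym; apply: edge_neq (@unrooted_irr H').
have [x1 [y1 [x1b y1s xy1]]] := lift_edge bs1.
have [x2 [y2 [x2b y2s xy2]]] := lift_edge bs2.
have [x3 [y3 [x3b y3s xy3]]] := lift_edge bs3.
have [b [fb degb]] : exists b, f b = b' /\ 2 < #|[set y | e b y]|.
  (* The fibre of [b'] has at most two vertices, so two of the three lifted edges start at the same
     one. *)
  case: (eqVneq x1 x2) xy2 => [<-|n12x] xy2.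
    by exists x1; split=> //; apply: lift_degree xy1 xy2 xy3 _ _ _ _ _;
      rewrite ?x1b ?y1s ?y2s ?y3s ?nsb.
  case: (eqVneq x2 x3) xy3 => [<-|n23x] xy3.
    by exists x2; split=> //; apply: lift_degree xy2 xy3 xy1 _ _ _ _ _;
      rewrite ?x1b ?x2b ?y1s ?y2s ?y3s ?nsb.
  have {}xy3 : e x1 y3.
    have := contraction_fibre (etrans x1b (esym x2b)) n12x.
    have := contraction_fibre (etrans x2b (esym x3b)) n23x.
    have nuv := edge_neq (@adj_irr _ _) uv.
    case/orP=> /andP[/eqP E2 /eqP E3] /orP[]/andP[/eqP E1 /eqP E2'];
      first [by rewrite E1 -E3 | by rewrite -E2 E2' eqxx in nuv].
  by exists x1; split=> //; apply: lift_degree xy3 xy1 xy2 _ _ _ _ _;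
      rewrite ?x1b ?x2b ?y1s ?y2s ?y3s ?nsb.
have nj' : j' != root H' by rewrite eq_sym (edge_neq (@adj_irr _ _) ij').
have [z [fz cz]] : exists j, (adj (graph H) (root H) j /\ f j != b') /\ connect e j b.
  move/f_adj: ij' => [_ [x [y [xi yj xy]]]].
  have cyb : connect e y b by apply: lift_connect_unrooted; rewrite ?yj ?fb.
  (* If the lifted edge does not start at the root, it starts at the vertex contracted with the
     root, which is then itself a neighbour of the root joined to [b]. *)
  case: (eqVneq x (root H)) xy => [->|nx] xy; first by exists y; rewrite yj.
  exists x; split; first (split; last by rewrite xi eq_sym).
    have [] := orP (contraction_fibre (etrans xi (esym f_root)) nx) => /andP[/eqP-> /eqP->];
      by rewrite // adj_sym.
  apply: connect_trans (connect1 _) cyb; rewrite /e /unrooted_adj /avoid nx xy andbT.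
  by apply: contraNneq nj' => yi; rewrite -yj yi f_root.
right; exists z, b; case: fz => iz nfz; split=> //.
by apply: contraNneq nfz => ->; apply/eqP.
Qed.

End ContractionObstructed.

Lemma Paw_obstructed : obstructed Paw.
Proof.
left; exists (inord 1), (inord 2); split.
  by rewrite /unrooted_adj /avoid /= /edge_list_adj -!val_eqE /= !inordK.
apply: (@connect_trans _ _ (inord 3)); apply: connect1;
  by rewrite /delete_edge /unrooted_adj /avoid /= /edge_list_adj -!val_eqE /= !inordK.
Qed.

Lemma S211_obstructed : obstructed S211.
Proof.
have E (x y : nat) : x < 5 -> y < 5 -> edge_list_adj [:: (0, 1); (1, 2); (2, 3); (2, 4)]
    (inord x : 'I_5) (inord y) =
  (x != y) && (((x, y) \in [:: (0, 1); (1, 2); (2, 3); (2, 4)])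
            || ((y, x) \in [:: (0, 1); (1, 2); (2, 3); (2, 4)])).
  by move=> x5 y5; rewrite /edge_list_adj -val_eqE /= !inordK.
have root_inord : root S211 = inord 0 by apply: val_inj; rewrite /= inordK.
have ne (x y : nat) : x < 5 -> y < 5 -> x != y -> (inord x : 'I_5) != inord y.
  by move=> x5 y5; apply: contraNneq => /(congr1 val) /=; rewrite !inordK // => ->.
right; exists (inord 1), (inord 2); rewrite root_inord; split.
- by rewrite /= E.
- exact: ne.
- by apply: connect1; rewrite /unrooted_adj /avoid root_inord !ne //= E.
apply/card_gt2P; exists (inord 1), (inord 3), (inord 4).
by rewrite !inE /unrooted_adj /avoid root_inord !ne //= !E.
Qed.

Lemma minor_obstructed (Q H : rgraph) : obstructed Q -> rooted_minor Q H -> obstructed H.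
Proof.
move=> obsQ; elim=> {H} [H|H H'|H H'|H H'].
- move=> [f [[g fK gK] f_root f_adj]].
  apply: (obstructed_injective (can_inj gK)) obsQ; first by rewrite -f_root fK.
  by move=> x y xy; rewrite -f_adj !gK.
- move=> [u [v [f [_ [g fK gK] f_root f_adj]]]] _.
  apply: (obstructed_injective (can_inj gK)); first by rewrite -f_root fK.
  by move=> x y; rewrite -{1}[x]gK -{1}[y]gK f_adj => /andP[].
- move=> [v [f [_ [f_inj _] f_root f_adj]]] _.
  by apply: (obstructed_injective f_inj) => // x y; rewrite f_adj.
- by move=> [u [v [f [uv [_ f_eq] f_root f_adj]]]] _; apply: contraction_obstructed uv f_eq f_root f_adj.
Qed.

(** * Yam graphs *)

(** Positions in the natural numbers turn questions about paths into linear arithmetic. *)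
Lemma path_index (T : finType) (G : sgraph T) : is_path G ->
  exists2 k : T -> nat, injective k &
    forall x y, adj G x y = ((k x).+1 == k y) || ((k y).+1 == k x).
Proof.
move=> [m [f [[g fK gK] f_adj]]]; exists (fun x => val (g x)).
  exact: inj_comp val_inj (can_inj gK).
by move=> x y; rewrite -{1}[x]gK -{1}[y]gK f_adj.
Qed.

Lemma path_degree (T : finType) (G : sgraph T) x : is_path G -> deg G x <= 2.
Proof.
move=> /path_index[k k_inj kP]; rewrite leqNgt; apply/negP => /card_gt2P[y1 [y2 [y3]]].
rewrite !inE !kP -!(inj_eq k_inj) => -[[h1 h2 h3] [h4 h5 h6]]; lia.
Qed.

(** A walk off [j] cannot jump over the position of [j], and on each side [j] has at most one
    neighbour. *)
Lemma path_acyclic (T : finType) (G : sgraph T) : is_path G -> ~ cyclic_vertex (adj G).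
Proof.
move=> /path_index[k k_inj kP] [j [x [y [nxy jx jy cxy]]]].
have side z : connect (avoid (adj G) j) x z -> (k z < k j) = (k x < k j).
  move=> cxz; apply: (connect_invariant (P := fun z => (k z < k j) = (k x < k j))) cxz _ => //.
  by move=> a b <- /and3P[]; rewrite kP -!(inj_eq k_inj); lia.
have := side y cxy; move: nxy jx jy; rewrite !kP -(inj_eq k_inj); lia.
Qed.

Section PathFromTree.
Variables (T : finType) (G : sgraph T).
Hypotheses (T_inh : inhabited T) (G_conn : connected_graph G)
  (acyclic : ~ cyclic_vertex (adj G)) (deg_le2 : forall x, deg G x <= 2).

Let good (s : seq T) := sorted (adj G) s && uniq s.

Lemma longest_path : exists s, [/\ good s, 0 < size s & forall t, good t -> size t <= size s].
Proof.
pose P n := [exists t : n.-tuple T, good t].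
have ex1 : exists n, P n.
  by case: T_inh => x; exists 1; apply/existsP; exists [tuple x].
have bnd n : P n -> n <= #|T|.
  by move=> /existsP[t /andP[_ /card_uniqP]]; rewrite size_tuple => <-; apply: max_card.
have Pt t : good t -> P (size t) by move=> gt; apply/existsP; exists (in_tuple t).
case: (ex_maxnP ex1 bnd) => n /existsP[s gs] maxn; exists s; rewrite size_tuple; split=> //.
  by case: T_inh => x; apply: (maxn 1); apply: (Pt [:: x]).
by move=> t /Pt /maxn.
Qed.

Lemma tree_is_path : is_path G.
Proof.
have [s [/andP[srt us] s_gt0 longest]] := longest_path; case: (T_inh) => x0.
have step k : k.+1 < size s -> adj G (nth x0 s k) (nth x0 s k.+1) by move/sortedP: srt => /(_ x0 k).
(* By maximality an end of [s] has no neighbour outside [s]; an inner vertex has its two neighbours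
   in [s] already. *)
have closed v w : v \in s -> adj G v w -> w \in s.
  move=> /(nthP x0)[k ks <-] vw; apply: contraT => nws.
  have [k0|k_gt0] := posnP k.
    suff /longest : good (w :: s) by rewrite /= ltnn.
    rewrite /good /= nws us andbT andbC /=; move: srt vw; rewrite k0.
    by case: (s) s_gt0 => //= v' s' _ -> vw; rewrite adj_sym vw.
  have [klast|knl] := eqVneq k.+1 (size s).
    suff /longest : good (rcons s w) by rewrite size_rcons ltnn.
    rewrite /good rcons_uniq nws us !andbT.
    have Ek : k = (size s).-1 by rewrite -klast.
    move: srt vw; rewrite Ek nth_last; case: (s) s_gt0 => //= v' s' _ ps vw.
    by rewrite rcons_path ps.
  have ks1 : k.+1 < size s by rewrite ltn_neqAle knl.
  have := deg_le2 (nth x0 s k); rewrite leqNgt => /negP; case; apply/card_gt2P.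
  exists (nth x0 s k.-1), (nth x0 s k.+1), w; rewrite !inE; split; split=> //.
  - by rewrite adj_sym; have := step k.-1; rewrite prednK //; apply.
  - exact: step.
  - by rewrite nth_uniq //; lia.
  - by apply: contraNneq nws => <-; rewrite mem_nth.
  - by apply: contraNneq nws => ->; rewrite mem_nth //; lia.
have all_s w : w \in s.
  apply: (connect_invariant (P := fun z => z \in s)) (G_conn (nth x0 s 0) w) _ => [a b|].
    exact: closed.
  exact: mem_nth.
(* A chord from position [a] to position [b] closes a cycle with the stretch of [s] from [a.+1] to
   [b]. *)
have consec a b : a < b -> b < size s -> adj G (nth x0 s a) (nth x0 s b) -> a.+1 = b.
  move=> ab bs adj_ab; apply/eqP; apply: contraT => nab; exfalso; apply: acyclic.
  have as1 : a.+1 < size s := leq_ltn_trans ab bs.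
  exists (nth x0 s a), (nth x0 s a.+1), (nth x0 s b); split=> //.
  - by rewrite nth_uniq.
  - exact: step.
  suff cab k : a.+1 + k < size s ->
      connect (avoid (adj G) (nth x0 s a)) (nth x0 s a.+1) (nth x0 s (a.+1 + k)).
    by have := cab (b - a.+1); rewrite subnKC //; apply.
  elim: k => [|k IHk] aks; first by rewrite addn0 connect0.
  rewrite addnS in aks *; have ak := ltnW aks.
  apply: connect_trans (IHk ak) (connect1 _).
  by rewrite /avoid step // !nth_uniq // ?(leq_trans _ as1) //; lia.
have [m Em] : exists m, size s = m.+1 by exists (size s).-1; rewrite prednK.
exists m, (fun k : 'I_m.+1 => nth x0 s k); split.
  have ltS (k : 'I_m.+1) : k < size s by rewrite Em.
  exists (fun w => inord (index w s)) => [k|w].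
    by rewrite index_uniq // inord_val.
  by rewrite inordK ?nth_index // -Em index_mem.
move=> a b; have as_ : a < size s by rewrite Em.
have bs : b < size s by rewrite Em.
apply/idP/orP => [|[/eqP E|/eqP E]].
- case: (ltngtP a b) => [ab|ba|/val_inj->]; last by rewrite adj_irr.
    by move/(consec _ _ ab bs)->; left.
  by rewrite adj_sym => /(consec _ _ ba as_)->; right.
- by rewrite -E step // E.
- by rewrite -E adj_sym step // E.
Qed.

End PathFromTree.

(* [g] identifies a graph [eU] with a union of components of [e]. *)
Section Component.
Variables (U V : finType) (eU : rel U) (e : rel V) (g : U -> V).
Hypotheses (g_inj : injective g) (g_e : forall a b, e (g a) (g b) = eU a b)
  (g_closed : forall a w, e (g a) w -> exists b, g b = w).

Lemma component_connect a w : connect e (g a) w -> exists2 b, g b = w & connect eU a b.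
Proof.
move=> c; apply: (connect_invariant (P := fun w => exists2 b, g b = w & connect eU a b)) c _.
  move=> _ w' [b <- cab] bw'; have [b' Eb'] := g_closed bw'; exists b' => //.
  by apply: connect_trans cab (connect1 _); rewrite -g_e Eb'.
by exists a.
Qed.

Lemma component_degree a : #|[set b | eU a b]| = #|[set w | e (g a) w]|.
Proof.
rewrite -(card_imset _ g_inj); apply: eq_card => w; rewrite inE.
apply/imsetP/idP => [[b + ->]|gaw]; first by rewrite inE g_e.
by have [b Eb] := g_closed gaw; exists b; rewrite // inE -g_e Eb.
Qed.

End Component.

Lemma component_cyclic (U V : finType) (eU : rel U) (e : rel V) (g : U -> V) j :
  injective g -> (forall a b, e (g a) (g b) = eU a b) ->
  (forall a w, e (g a) w -> exists b, g b = w) ->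
  (exists x y, [/\ x != y, e (g j) x, e (g j) y & connect (avoid e (g j)) x y]) ->
  cyclic_vertex eU.
Proof.
move=> g_inj g_e g_closed [x [y [nxy jx jy cxy]]].
have [a Ea] := g_closed _ _ jx; rewrite -Ea in nxy jx cxy.
have [||b Eb cab] := @component_connect _ _ (avoid eU j) _ g _ _ _ _ cxy.
- by move=> ? ?; rewrite /avoid g_e !(inj_eq g_inj).
- by move=> ? ? /avoid_sub /g_closed.
exists j, a, b; rewrite -!g_e Eb; split=> //.
by apply: contraNneq nxy => ->; rewrite Eb.
Qed.

Section Yam.
Variable H : rgraph.
Let G := graph H.
Let i := root H.
Let e : rel (vertex H) := @unrooted_adj H.
Let Gi := induced G [set~ i].

Section OneComponent.
Variable x : {x | x \in [set~ i]}.
Let C := component Gi x.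
Let GC := induced Gi C.
(** Vertices of a component sit under two subset types, that of [G - i] and that of the component;
    [g] forgets both. *)
Let g (z : {y | y \in C}) : vertex H := val (val z).

Lemma yam_inj : injective g.
Proof. by move=> a b /val_inj/val_inj. Qed.

Lemma yam_root z : g z != i.
Proof. by have := valP (val z); rewrite !inE. Qed.

Lemma yam_adj a b : e (g a) (g b) = adj GC a b.
Proof. by rewrite /e /unrooted_adj /avoid !yam_root. Qed.

Lemma yam_closed a w : e (g a) w -> exists b, g b = w.
Proof.
move=> /and3P[_ nw aw]; have w_in : w \in [set~ i] by rewrite !inE.
have wC : Sub w w_in \in C.
  have := valP a; rewrite !inE => cxa; apply: connect_trans cxa (connect1 _).
  by rewrite /= /induced_adj SubK.
by exists (Sub (Sub w w_in) wC); rewrite /g !SubK.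
Qed.

Lemma yam_base : exists z, g z = val x.
Proof.
have xC : x \in C by rewrite inE connect0.
by exists (Sub x xC); rewrite /g SubK.
Qed.

Lemma yam_connected : connected_graph GC.
Proof.
have xC : x \in C by rewrite inE connect0.
have conn_x (a : {y | y \in C}) : connect (adj GC) (Sub x xC) a.
  have val_closed (b : {y | y \in C}) w : adj Gi (val b) w -> exists c : {y | y \in C}, val c = w.
    move=> bw; have wC : w \in C.
      by have := valP b; rewrite !inE => cxb; apply: connect_trans cxb (connect1 bw).
    by exists (Sub w wC).
  have := valP a; rewrite inE => cxa.
  have [b Eb] := @component_connect _ _ (adj GC) (adj Gi) val (fun _ _ => erefl) val_closed
    (Sub x xC) (val a) cxa.
  by rewrite (val_inj Eb).
move=> a b; apply: connect_trans (conn_x b).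
by rewrite connectC //; apply: adj_sym.
Qed.

Lemma yam_deg z : deg GC z = #|[set w | e (g z) w]|.
Proof. exact: component_degree yam_inj yam_adj yam_closed z. Qed.

Lemma yam_connect a b : connect e (g a) (g b).
Proof. by apply: connect_map (yam_connected a b) => c d; rewrite -yam_adj; apply: connect1. Qed.

Lemma yam_acyclic : ~ cyclic_vertex e -> ~ cyclic_vertex (adj GC).
Proof.
move=> acyclic [j [y [z [nyz jy jz cyz]]]]; apply: acyclic.
exists (g j), (g y), (g z); rewrite !yam_adj (inj_eq yam_inj); split=> //.
apply: connect_map cyz => a b /and3P[na nb ab]; apply: connect1.
by rewrite /avoid !(inj_eq yam_inj) na nb yam_adj.
Qed.

End OneComponent.

Lemma yam_not_obstructed : yam_graph H -> ~ obstructed H.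
Proof.
move=> [_ yam] [nonbridge|[j [b [ij njb cjb degb]]]].
  have [j [x [y [nxy jx jy cxy]]]] :=
    nonbridge_cyclic_vertex (@unrooted_sym H) (@unrooted_irr H) nonbridge.
  have [nj _ _] := and3P jx; have j_in : j \in [set~ i] by rewrite !inE.
  have [z] := yam_base (Sub j j_in); rewrite SubK => Ez.
  have cyc : cyclic_vertex (adj (induced Gi (component Gi (Sub j j_in)))).
    apply: (component_cyclic (@yam_inj _) (@yam_adj _) (@yam_closed _) (j := z)).
    by exists x, y; rewrite Ez.
  have [[[[_ _ nocycle] _]|/path_acyclic//] _] := yam (Sub j j_in).
  apply: nocycle; apply: cyclic_vertex_ucycle cyc; [exact: adj_sym | exact: adj_irr].
have nj : j != i by rewrite eq_sym (edge_neq (@adj_irr _ _) ij).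
have j_in : j \in [set~ i] by rewrite !inE.
have [z] := yam_base (Sub j j_in); rewrite SubK => Ez.
have [|zb Eb _] := component_connect (@yam_adj _) (@yam_closed _) (a := z) (w := b).
  by rewrite Ez.
have degz : 3 <= deg (induced Gi (component Gi (Sub j j_in))) zb by rewrite yam_deg Eb.
have [[star|/path_degree degle] centre] := yam (Sub j j_in); last first.
  by have := degle zb; rewrite leqNgt degz.
have [_ degzj] := centre star z (etrans (congr1 _ Ez) ij).
case: star => _ [c [_ c_uniq]].
by move: njb; rewrite -Ez -Eb -(c_uniq _ degz) -(c_uniq _ degzj) eqxx.
Qed.

Lemma not_obstructed_yam : connected_graph G -> ~ obstructed H -> yam_graph H.
Proof.
move=> G_conn nobs; split=> // x.
have acyclic : ~ cyclic_vertex e.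
  move=> cyc; apply: nobs; left.
  exact: (cyclic_vertex_nonbridge (@unrooted_sym H) (@unrooted_irr H)).
set C := component Gi x; set GC := induced Gi C.
have GC_acyclic := yam_acyclic (x := x) acyclic.
have [z0 Ez0] := yam_base x.
have tree : is_tree GC.
  split; [by exists; exact: z0 | exact: yam_connected |].
  by move=> [s [s3 /(ucycle_cyclic_vertex (@adj_sym _ GC) s3)]].
have centre z c : adj G i (val (val z)) -> 3 <= deg GC c -> z = c.
  move=> iz degc; apply/eqP; apply: contraT => nzc; exfalso; apply: nobs; right.
  exists (val (val z)), (val (val c)); split=> //.
  - exact: yam_connect.
  - by rewrite -yam_deg.
split; last first.
  by move=> star z iz; split=> //; case: star => _ [c [degc _]]; rewrite (centre z c).
(* Connectedness of [G] gives each component a neighbour [j] of [i], and by [centre] every vertex of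
   degree at least 3 in the component equals [j]: this is the uniqueness of the centre. *)
have [j ij] : exists z : {y | y \in C}, adj G i (val (val z)).
  have nx : val x != i by have := valP x; rewrite !inE.
  have [w [nw cxw wi]] := first_hit (G_conn (val x) i) nx.
  rewrite -Ez0 in cxw.
  have [b Eb _] := component_connect (@yam_adj x) (@yam_closed x) cxw.
  by exists b; rewrite adj_sym Eb.
have [[c degc]|small] := pselect (exists c, 3 <= deg GC c).
  left; split=> //; exists c; split=> // d degd.
  by rewrite -(centre j c) // -(centre j d).
right; apply: tree_is_path;
  [by exists; exact: z0 | exact: yam_connected | exact: GC_acyclic |].
by move=> z; rewrite leqNgt; apply/negP => degz; apply: small; exists z.
Qed.

End Yam.

(** * Nullity through kernels of row vectors *)

Section LinearAlgebra.
Import GRing.Theory Num.Theory.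
Local Open Scope ring_scope.
Variable R : realType.

Lemma nullityE m (A : 'M[R]_m) : nullity A = \rank (kermx A).
Proof. by rewrite /nullity mxrank_coker mxrank_ker. Qed.

Lemma nullity1P m (A : 'M[R]_m) (u : 'rV_m) : u != 0 -> u *m A = 0 ->
  (forall w : 'rV_m, w *m A = 0 -> exists a, w = a *: u) -> nullity A = 1%N.
Proof.
move=> nu uA kerA; rewrite nullityE; have -> : 1%N = \rank u by rewrite rank_rV nu.
apply/eqmx_rank/andP; split; last exact/sub_kermxP.
by apply/rV_subP => w /sub_kermxP/kerA[a ->]; apply: scalemx_sub.
Qed.

Lemma nullity2P m (A : 'M[R]_m) (u1 u2 : 'rV_m) :
  (forall a b, a *: u1 + b *: u2 = 0 -> a = 0 /\ b = 0) ->
  u1 *m A = 0 -> u2 *m A = 0 ->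
  (forall w : 'rV_m, w *m A = 0 -> exists a b, w = a *: u1 + b *: u2) -> nullity A = 2%N.
Proof.
move=> indep u1A u2A kerA; rewrite nullityE; pose U := col_mx u1 u2.
have rU : \rank U = 2%N.
  apply/eqP; rewrite -[_ == _]/(row_free U); apply: inj_row_free => c.
  rewrite -[c]hsubmxK mul_row_col [lsubmx c]mx11_scalar [rsubmx c]mx11_scalar !mul_scalar_mx.
  by move=> /indep[-> ->]; rewrite !raddf0 row_mx0.
rewrite -rU; apply/eqmx_rank/andP; split; last first.
  by rewrite col_mx_sub; apply/andP; split; apply/sub_kermxP.
apply/rV_subP => w /sub_kermxP/kerA[a [b ->]].
by rewrite addmx_sub // scalemx_sub // -addsmxE ?addsmxSl ?addsmxSr.
Qed.

(** One linear condition lowers the dimension of a kernel by at most one; here it is appended to [A]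
    as an extra column. *)
Lemma nullity_ge2_vanish m (A : 'M[R]_m) (k : 'I_m) : (2 <= nullity A)%N ->
  exists w : 'rV_m, [/\ w != 0, w *m A = 0 & w 0 k = 0].
Proof.
rewrite /nullity mxrank_coker => nul2; pose c : 'cV[R]_m := delta_mx k 0.
have rk : (\rank (row_mx A c) <= \rank A + 1)%N.
  rewrite -mxrank_tr tr_row_mx -addsmxE.
  apply: leq_trans (mxrank_adds_leqif _ _) _; rewrite !mxrank_tr leq_add2l.
  exact: rank_leq_col.
have : kermx (row_mx A c) != 0.
  by rewrite -mxrank_eq0 mxrank_ker -lt0n subn_gt0; apply: leq_ltn_trans rk _; lia.
move=> /rowV0Pn[w /sub_kermxP]; rewrite mul_mx_row => wAc nw; exists w.
move: wAc; rewrite -[0]hsubmxK => /eq_row_mx[-> wc]; split; rewrite ?linear0 //.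
move/matrixP/(_ 0 0): wc; rewrite !mxE (bigD1 k) //= big1 ?addr0.
  by rewrite mxE !eqxx mulr1.
by move=> l nl; rewrite mxE (negPf nl) mulr0.
Qed.

Lemma nullity1_scale m (A : 'M[R]_m) (x y : 'rV_m) : nullity A = 1%N ->
  x != 0 -> x *m A = 0 -> y *m A = 0 -> exists a, y = a *: x.
Proof.
rewrite nullityE => nul1 nx /sub_kermxP xA /sub_kermxP yA; apply/sub_rVP.
apply: submx_trans yA _; have [_] := mxrank_leqif_sup xA.
by rewrite nul1 rank_rV nx eqxx => <-.
Qed.

End LinearAlgebra.

(** * The kernel of [A(i)] inside the full coordinate space *)

Section DeletedRow.
Import GRing.Theory Num.Theory.
Local Open Scope ring_scope.
Variables (R : realType) (n : nat) (i : 'I_n) (A : 'M[R]_n).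

Definition lift_row (w : 'rV[R]_n.-1) : 'rV[R]_n :=
  \row_k (if unlift i k is Some k' then w 0 k' else 0).

Lemma lift_row_root w : lift_row w 0 i = 0.
Proof. by rewrite mxE unlift_none. Qed.

Lemma lift_row_lift w k : lift_row w 0 (lift i k) = w 0 k.
Proof. by rewrite mxE liftK. Qed.

Lemma col'_lift_row w : col' i (lift_row w) = w.
Proof. by apply/rowP => k; rewrite mxE lift_row_lift. Qed.

Lemma lift_row_col' (x : 'rV_n) : x 0 i = 0 -> lift_row (col' i x) = x.
Proof. by move=> xi; apply/rowP => k; rewrite mxE; case: unliftP => [k' ->|->]; rewrite ?mxE ?xi. Qed.

Lemma mul_deleted (x : 'rV_n) k : x 0 i = 0 ->
  (col' i x *m row' i (col' i A)) 0 k = (x *m A) 0 (lift i k).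
Proof.
move=> xi; rewrite !mxE (bigD1_ord i) //= xi mul0r add0r.
by apply: eq_bigr => l _; rewrite !mxE.
Qed.

Lemma deleted_kernel (x : 'rV_n) : x 0 i = 0 ->
  col' i x *m row' i (col' i A) = 0 <-> (forall k, k != i -> (x *m A) 0 k = 0).
Proof.
move=> xi; split=> [xA k|xA].
  by case: (unliftP i k) => [k' ->|->]; rewrite ?eqxx // -mul_deleted // xA mxE.
by apply/rowP => k; rewrite mul_deleted // xA ?mxE // eq_sym neq_lift.
Qed.

(** A kernel of dimension 2, extended by zero at [i], does not fit into the kernel of [A], which has
    dimension 1: this gives [v]. The same dimension leaves room for one prescribed zero. *)
Lemma nullity_pair12 : nullity_pair i A = (1%N, 2%N) ->
  (exists v : 'rV_n, [/\ v 0 i = 0, forall k, k != i -> (v *m A) 0 k = 0 & (v *m A) 0 i != 0]) /\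
  (forall j, exists w : 'rV_n,
     [/\ w != 0, w 0 i = 0, w 0 j = 0 & forall k, k != i -> (w *m A) 0 k = 0]).
Proof.
case=> nulA nulAi.
have ker j : exists w : 'rV_n,
    [/\ w != 0, w 0 i = 0, w 0 j = 0 & forall k, k != i -> (w *m A) 0 k = 0].
  have n1 : (0 < n.-1)%N.
    by have := rank_leq_row (cokermx (row' i (col' i A))); move: nulAi; rewrite /nullity; lia.
  (* For [j = i] any index of [A(i)] will do, because the extension vanishes at [i] anyway. *)
  have [j0 j0P] : exists j0 : 'I_n.-1, forall w : 'rV[R]_n.-1, w 0 j0 = 0 -> lift_row w 0 j = 0.
    case: (unliftP i j) => [j0 ->|->]; first by exists j0 => w; rewrite lift_row_lift.
    by exists (Ordinal n1) => w _; rewrite lift_row_root.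
  have [|w [nw wA wj]] := @nullity_ge2_vanish R _ (row' i (col' i A)) j0; first by rewrite nulAi.
  exists (lift_row w); split; [|exact: lift_row_root|exact: j0P|].
    by apply: contraNneq nw => w0; rewrite -(col'_lift_row w) w0 linear0.
  by apply: (proj1 (deleted_kernel (lift_row_root w))); rewrite col'_lift_row.
split=> //; apply: contrapT => nex.
have kerA (x : 'rV_n) : x 0 i = 0 -> (forall k, k != i -> (x *m A) 0 k = 0) -> x *m A = 0.
  move=> xi xA; apply/rowP => k; rewrite [RHS]mxE; case: (eqVneq k i) => [->|/xA //].
  by apply/eqP; apply: contraT => nx; case: nex; exists x.
have [x [nx xi _ /(kerA x xi) xA]] := ker i.
have /rV0Pn[k nxk] := nx.
have [y [ny yi yk /(kerA y yi) yA]] := ker k.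
have [a Ey] := nullity1_scale nulA nx xA yA.
move: yk; rewrite Ey mxE => /eqP; rewrite mulf_eq0 (negPf nxk) orbF => /eqP a0.
by rewrite Ey a0 scale0r eqxx in ny.
Qed.

End DeletedRow.

(** * From a matrix with the SNIP to an obstruction *)

Section AllowsObstructed.
Import GRing.Theory Num.Theory.
Local Open Scope ring_scope.
Variables (R : realType) (n : nat) (G : sgraph 'I_n) (i : 'I_n) (A : 'M[R]_n).
Hypotheses (A_S : in_S G A) (A_pair : nullity_pair i A = (1%N, 2%N)) (A_SNIP : SNIP i A).

Let H := RGraph G i.
Let e : rel 'I_n := @unrooted_adj H.
Let e_sym : symmetric e := @unrooted_sym H.
Let e_irr : irreflexive e := @unrooted_irr H.

Let A_sym j k : A j k = A k j.
Proof. by case: A_S => At _; rewrite -{1}At mxE. Qed.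

Let A_e j k : j != i -> k != i -> j != k -> A j k != 0 -> e j k.
Proof. by case: A_S => _ Aadj ji ki jk; rewrite Aadj // /e /unrooted_adj /avoid ji ki. Qed.

Definition restrict_row (C : pred 'I_n) (x : 'rV[R]_n) : 'rV[R]_n :=
  \row_k (if C k then x 0 k else 0).

Lemma restrict_row_ker (C : pred 'I_n) (x : 'rV[R]_n) k :
  (forall l, x 0 l != 0 -> A l k != 0 -> C l = C k) ->
  (x *m A) 0 k = 0 -> (restrict_row C x *m A) 0 k = 0.
Proof.
move=> CP xA; transitivity ((if C k then 1 else 0) * (x *m A) 0 k); last by rewrite xA mulr0.
rewrite !mxE big_distrr /=; apply: eq_bigr => l _; rewrite mxE.
have [->|nx] := eqVneq (x 0 l) 0; first by rewrite if_same !mul0r mulr0.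
have [->|nA] := eqVneq (A l k) 0; first by rewrite !mulr0.
by rewrite (CP l nx nA); case: (C k); rewrite ?mul1r ?mul0r.
Qed.

Let ker (x : 'rV[R]_n) := x 0 i = 0 /\ forall k, k != i -> (x *m A) 0 k = 0.

(** The symmetric matrix [x^T *m y + y^T *m x] satisfies all conditions of the SNIP when the
    supports are disjoint and no entry of [A] joins them. So it is zero, which is possible only if
    one factor is. *)
Lemma SNIP_disjoint (x y : 'rV[R]_n) : ker x -> ker y ->
  (forall a b, x 0 a != 0 -> y 0 b != 0 -> (a != b) && (A a b == 0)) ->
  x = 0 \/ y = 0.
Proof.
move=> [_ xA] [_ yA] disj.
have prod0 a b : A a b != 0 -> x 0 a * y 0 b = 0.
  move=> nA; apply/eqP; apply: contraT; rewrite mulf_eq0 negb_or => /andP[nx ny].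
  by have /andP[_] := disj _ _ nx ny; rewrite (negPf nA).
have diag0 a : x 0 a * y 0 a = 0.
  apply/eqP; apply: contraT; rewrite mulf_eq0 negb_or => /andP[nx ny].
  by have := disj _ _ nx ny; rewrite eqxx.
pose X : 'M[R]_n := \matrix_(a, b) (x 0 a * y 0 b + y 0 a * x 0 b).
have X0 : X = 0.
  apply: A_SNIP.
  - by apply/matrixP => a b; rewrite !mxE addrC [y _ _ * _]mulrC [x _ b * _]mulrC mulrC.
  - apply/matrixP => a b; rewrite !mxE.
    have [->|nA] := eqVneq (A a b) 0; first by rewrite mul0r.
    rewrite prod0 // [y _ _ * _]mulrC prod0; last by rewrite A_sym.
    by rewrite addr0 mulr0.
  - apply/matrixP => a b; rewrite !mxE; case: eqVneq => [->|_]; last by rewrite mul0r.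
    by rewrite [y _ _ * _]mulrC diag0 addr0 mulr0.
  apply/matrixP => a b; rewrite [RHS]mxE mxE.
  transitivity ((x *m A) 0 (lift i a) * y 0 b + (y *m A) 0 (lift i a) * x 0 b).
    rewrite !mxE !big_distrl -big_split /=; apply: eq_bigr => l _.
    by rewrite mxE A_sym mulrDr !mulrA ![A _ _ * _]mulrC.
  by rewrite xA ?yA ?mul0r ?addr0 // eq_sym neq_lift.
have [->|/rV0Pn[a na]] := eqVneq x 0; [by left | right].
apply/rowP => b; rewrite [RHS]mxE; apply/eqP; apply: contraT => nb.
have ya : y 0 a = 0 by apply/eqP; have := diag0 a; move/eqP; rewrite mulf_eq0 (negPf na).
move/matrixP/(_ a b): X0; rewrite !mxE ya mul0r addr0 => /eqP.
by rewrite mulf_eq0 (negPf na) (negPf nb).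
Qed.

(** At a vertex [b] of degree at most 2 with neighbours [a] and [c], the kernel equation at [b] with
    [w a = w b = 0] leaves the single term of [c], whose coefficient is nonzero. *)
Lemma propagate_zero (w : 'rV[R]_n) (p : seq 'I_n) (a b : 'I_n) :
  ker w -> e b a -> w 0 a = 0 -> w 0 b = 0 -> path e b p -> uniq [:: a, b & p] ->
  (forall z, z \in b :: p -> (#|[set y | e z y]| <= 2)%N) -> w 0 (last b p) = 0.
Proof.
move=> [wi wA]; elim: p a b => //= c p IHp a b eba wa wb /andP[ebc pc].
rewrite !inE !negb_or => /and4P[/and3P[nab nac nap] /andP[nbc nbp] ncp up] deg2.
have wc : w 0 c = 0.
  have [nbi nci _] := and3P ebc.
  have := wA b nbi; rewrite mxE (bigD1 c) //= big1 ?addr0.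
    move/eqP; rewrite mulf_eq0 => /orP[/eqP//|/eqP Acb].
    by case: A_S => _ /(_ c b); rewrite eq_sym nbc Acb eqxx adj_sym => /(_ isT); case/and3P: ebc => _ _ ->.
  move=> l nlc; apply/eqP; rewrite mulf_eq0; apply: contraT; rewrite negb_or => /andP[nwl nAl].
  have nwP z : w 0 z = 0 -> l != z by move=> wz; apply: contraNneq nwl => ->; rewrite wz.
  have ebl : e b l by rewrite e_sym; apply: A_e => //; apply: nwP.
  have : (2 < #|[set y | e b y]|)%N.
    by apply/card_gt2P; exists a, c, l; rewrite !inE eba ebc ebl nac (eq_sym c) nlc nwP.
  by rewrite ltnNge deg2 // mem_head.
apply: (IHp b c) => //.
- by rewrite e_sym.
- by rewrite /= inE negb_or nbc nbp ncp.
- by move=> z zp; apply: deg2; rewrite inE zp orbT.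
Qed.

Lemma allows_obstructed : obstructed H.
Proof.
apply: contrapT => nobs.
have acyclic : ~ cyclic_vertex e.
  by move=> cyc; apply: nobs; left; apply: cyclic_vertex_nonbridge cyc.
have [[v [vi vA nvA]] ex_ker] := nullity_pair12 A_pair.
have [j nvj] : exists j, v 0 j * A j i != 0.
  apply: contrapT => nex; move: nvA; rewrite mxE big1 ?eqxx // => l _.
  by apply/eqP; apply: contraT => nl; case: nex; exists l.
move: nvj; rewrite mulf_eq0 negb_or => /andP[nvj nAj].
have nji : j != i by apply: contraNneq nvj => ->; rewrite vi.
have ij : adj G i j by case: A_S => _ /(_ j i nji); rewrite nAj adj_sym => <-.
have deg2 b : j != b -> connect e j b -> (#|[set y | e b y]| <= 2)%N.
  by move=> njb cjb; rewrite leqNgt; apply/negP => degb; apply: nobs; right; exists j, b.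
pose C : pred 'I_n := connect e j.
have Ci : ~~ C i by apply/negP => /connect_avoid_neq/(_ nji); rewrite eqxx.
have closedC a b : a != i -> b != i -> A a b != 0 -> C a = C b.
  move=> nai nbi nA; have [-> //|nab] := eqVneq a b.
  have eab := A_e nai nbi nab nA.
  by apply: same_connect_r; rewrite ?connect1 //; apply: sym_connect_sym.
have nz (x : 'rV[R]_n) l : x 0 i = 0 -> x 0 l != 0 -> l != i.
  by move=> xi; apply: contraNneq => ->; rewrite xi.
have kerC x : ker x -> ker (restrict_row C x).
  move=> [xi xA]; split=> [|k nki]; first by rewrite mxE xi if_same.
  by apply: restrict_row_ker (xA k nki) => l /(nz _ _ xi) nli; apply: closedC.
have kerNC x : ker x -> ker (restrict_row (predC C) x).
  move=> [xi xA]; split=> [|k nki]; first by rewrite mxE xi if_same.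
  by apply: restrict_row_ker (xA k nki) => l /(nz _ _ xi) nli nA /=; rewrite (closedC l k).
(* No edge joins the part of [v] inside [C] to the part of [x] outside [C]; the former is nonzero at
   [j], so the latter vanishes. *)
have supp x l : ker x -> x 0 l != 0 -> C l.
  move=> kx nxl; apply: contraT => nCl.
  have [|v0|x0] := SNIP_disjoint (kerC v (conj vi vA)) (kerNC x kx).
  - move=> a b; rewrite !mxE; case: ifP => [Ca nva|_]; last by rewrite eqxx.
    case: ifP => [/= nCb nxb|_]; last by rewrite eqxx.
    rewrite (contraTneq _ Ca) => [/=|->//].
    apply: contraT => nA; move: nCb.
    by rewrite -(closedC a b (nz _ _ vi nva) (nz _ _ (proj1 kx) nxb) nA) Ca.
  - by move/rowP/(_ j): v0; rewrite !mxE /C connect0 => v0; rewrite v0 eqxx in nvj.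
  - by move/rowP/(_ l): x0; rewrite !mxE /= nCl => x0; rewrite x0 eqxx in nxl.
have [w [nw wi wj wA]] := ex_ker j.
have /rV0Pn[s nws] := nw.
have njs : s != j by apply: contraNneq nws => ->; rewrite wj.
have cjs : connect e j s by apply: supp nws.
have csj : connect e s j by rewrite connectC.
have [x [nxj csx exj]] := first_hit csj njs.
have csym : connect_sym (avoid e j) by apply: sym_connect_sym; apply: avoid_sym.
pose L : pred 'I_n := connect (avoid e j) s.
pose wL := restrict_row L w.
have wLA k : k != i -> k != j -> (wL *m A) 0 k = 0.
  move=> nki nkj; apply: restrict_row_ker (wA k nki) => l nwl nA.
  have nli := nz _ _ wi nwl; have nlj : l != j by apply: contraNneq nwl => ->; rewrite wj.
  have [-> //|nlk] := eqVneq l k.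
  by apply: same_connect_r => //; rewrite connect1 // /avoid nlj nkj A_e.
(* Evaluate [wL *m A *m v^T] in two ways. As [v *m A] is zero off [i] and [wL i = 0], it is 0; as
   [wL *m A] is zero off [i] and [j] and [v i = 0], it is the entry at [j] times [v j]. *)
have wLj : (wL *m A) 0 j = 0.
  have : (wL *m A *m v^T) 0 0 = 0.
    rewrite -mulmxA -[A]trmxK -trmx_mul; case: A_S => -> _; rewrite mxE big1 // => l _.
    rewrite !mxE; have [->|nli] := eqVneq l i; first by rewrite wi if_same mul0r.
    by have := vA l nli; rewrite mxE => ->; rewrite mulr0.
  rewrite mxE (bigD1 j) //= big1 ?addr0 => [|l nlj].
    by move/eqP; rewrite mulf_eq0 [v^T _ _]mxE (negPf nvj) orbF => /eqP.
  rewrite [v^T _ _]mxE; have [->|nli] := eqVneq l i; first by rewrite vi mulr0.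
  by rewrite wLA // mul0r.
(* By acyclicity [x] is the only neighbour of [j] in [L], so the equation at [j] reduces to the term
   of [x]. *)
have wx : w 0 x = 0.
  have nxi : x != i by case/and3P: exj.
  move: wLj; rewrite mxE (bigD1 x) //= big1 ?addr0 => [|l nlx].
    rewrite mxE /L csx => /eqP; rewrite mulf_eq0 => /orP[/eqP //|].
    by case: A_S => _ Aadj; apply/contraTeq => _; rewrite Aadj //; case/and3P: exj.
  rewrite mxE; case: ifP => [Ll|_]; last by rewrite mul0r.
  apply/eqP; apply: contraT; rewrite mulf_eq0 negb_or => /andP[nwl nAl].
  exfalso; apply: acyclic; exists j, x, l; split; rewrite 1?[_ == l]eq_sym //.
  - by rewrite e_sym.
  - rewrite e_sym; apply: A_e => //; first exact: nz nwl.
    by apply: contraNneq nwl => ->; rewrite wj.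
  - by apply: connect_trans Ll; rewrite csym.
have cxs : connect (avoid e j) x s by rewrite csym.
case/connectP: cxs => p pp Es; case/shortenP: pp Es => q pq uq _ Es.
suff : w 0 s = 0 by move/eqP; rewrite (negPf nws).
have avoid_q z : z \in x :: q -> z != j /\ connect e j z.
  move=> zq; have cxz : connect (avoid e j) x z.
    by case/splitPl: q / zq pq {uq Es} => q1 q2 <-; rewrite cat_path => /andP[pq1 _]; apply/connectP; exists q1.
  split; first exact: connect_avoid_neq cxz nxj.
  apply: (@connect_trans _ _ x); first by rewrite connect1 // e_sym.
  by apply: connect_sub cxz => ? ? /avoid_sub; apply: connect1.
rewrite Es; apply: (propagate_zero (a := j)) => //.
- by apply: sub_path pq; apply: avoid_sub.
- by rewrite [uniq _]/= -/(uniq (x :: q)) uq andbT; apply/negP => /avoid_q[]; rewrite eqxx.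
- by move=> z /avoid_q[nzj cjz]; apply: deg2; rewrite 1?eq_sym.
Qed.

End AllowsObstructed.

(** * Bordering a matrix of nullity 2 *)

Section BorderedMatrix.
Import GRing.Theory Num.Theory.
Local Open Scope ring_scope.
Variables (R : realType) (n : nat) (G : sgraph 'I_n) (i : 'I_n).

(** The all-ones vector on the neighbours of [i] works unless its product with [u] is 0; then
    doubling the entry at [j] changes the product to [u j]. *)
Lemma generic_border (u : 'rV[R]_n) j : adj G i j -> u 0 j != 0 ->
  exists2 b : 'rV[R]_n, (forall k, (b 0 k != 0) = adj G i k) & \sum_k u 0 k * b 0 k != 0.
Proof.
move=> ij nuj; pose s := \sum_k u 0 k * (adj G i k)%:R.
have [s0|ns] := eqVneq s 0; last first.
  exists (\row_k (adj G i k)%:R) => [k|]; last by under eq_bigr do rewrite mxE.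
  by rewrite mxE; case: adj; rewrite ?oner_eq0 ?eqxx.
exists (\row_k ((adj G i k)%:R + (k == j)%:R)) => [k|].
  rewrite mxE; have [->|_] := eqVneq k j; first by rewrite ij -natrD pnatr_eq0.
  by rewrite addr0; case: adj; rewrite ?oner_eq0 ?eqxx.
suff -> : \sum_k u 0 k * (\row_k ((adj G i k)%:R + (k == j)%:R)) 0 k = s + u 0 j by rewrite s0 add0r.
rewrite /s; under eq_bigr do rewrite mxE mulrDr; rewrite big_split /=; congr (_ + _).
rewrite (bigD1 j) //= eqxx mulr1 big1 ?addr0 // => k /negPf->; exact: mulr0.
Qed.

(** [B] is the direct sum of the entry 1 at [i] and a matrix of [G - i], so its kernel vectors
    vanish at [i] and deleted rows are avoided. The hypothesis [strong] is the strong Arnold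
    property of the second block. *)
Variables (B : 'M[R]_n) (u1 u2 : 'rV[R]_n) (j : 'I_n).
Hypotheses (B_sym : forall k l, B k l = B l k) (B_ii : B i i = 1)
  (B_i : forall k, k != i -> B i k = 0)
  (B_adj : forall k l, k != l -> k != i -> l != i -> (B k l != 0) = adj G k l)
  (indep : forall a c, a *: u1 + c *: u2 = 0 -> a = 0 /\ c = 0)
  (u1B : u1 *m B = 0) (u2B : u2 *m B = 0)
  (kerB : forall w : 'rV_n, w *m B = 0 -> exists a c, w = a *: u1 + c *: u2)
  (ij : adj G i j) (u1j : u1 0 j != 0).
Hypothesis strong : forall X : 'M[R]_n, (forall k l, X k l = X l k) ->
  (forall k, row k X *m B = 0) -> (forall k, X k k = 0) ->
  (forall k l, k != i -> l != i -> adj G k l -> X k l = 0) -> X = 0.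

Let mulB_i (w : 'rV[R]_n) : (w *m B) 0 i = w 0 i.
Proof.
rewrite mxE (bigD1 i) //= B_ii mulr1 big1 ?addr0 // => k nk.
by rewrite B_sym B_i // mulr0.
Qed.

Let kerB_i (w : 'rV[R]_n) : w *m B = 0 -> w 0 i = 0.
Proof. by move=> wB; rewrite -mulB_i wB mxE. Qed.

Lemma allows_bordered : allows_with_SNIP R G i 1 2.
Proof.
have [b b_adj nub] := generic_border ij u1j.
pose dot (w : 'rV[R]_n) := \sum_k w 0 k * b 0 k.
have {}nub : dot u1 != 0 by [].
have b_i : b 0 i = 0 by apply/eqP; apply: contraFT (adj_irr G i); rewrite b_adj.
have dotD a c : dot (a *: u1 + c *: u2) = a * dot u1 + c * dot u2.
  rewrite /dot !big_distrr -big_split /=; apply: eq_bigr => k _.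
  by rewrite !mxE mulrDl !mulrA.
pose A : 'M[R]_n := \matrix_(k, l) (B k l + (k == i)%:R * b 0 l + (l == i)%:R * b 0 k).
have mulA (w : 'rV[R]_n) k :
    (w *m A) 0 k = (w *m B) 0 k + w 0 i * b 0 k + (k == i)%:R * dot w.
  rewrite [LHS]mxE [X in X + _ + _]mxE.
  have -> : w 0 i * b 0 k = \sum_l w 0 l * ((l == i)%:R * b 0 k).
    rewrite (bigD1 i) //= eqxx mul1r big1 ?addr0 // => l /negPf->.
    by rewrite mul0r mulr0.
  rewrite /dot big_distrr -!big_split /=; apply: eq_bigr => l _.
  by rewrite mxE !mulrDr [(k == i)%:R * (_ * _)]mulrCA.
have A_sym k l : A k l = A l k.
  by rewrite !mxE B_sym -!addrA; congr (_ + _); rewrite addrC.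
have mulA_root (w : 'rV[R]_n) k : w 0 i = 0 -> k != i -> (w *m A) 0 k = (w *m B) 0 k.
  by move=> wi /negPf nk; rewrite mulA wi nk !mul0r !addr0.
have kerA_B (w : 'rV[R]_n) : w 0 i = 0 -> (forall k, k != i -> (w *m A) 0 k = 0) -> w *m B = 0.
  move=> wi wA; apply/rowP => k; rewrite [RHS]mxE.
  have [->|nk] := eqVneq k i; first by rewrite mulB_i.
  by rewrite -mulA_root ?wA.
have u1i := kerB_i u1B; have u2i := kerB_i u2B.
have uA (u : 'rV[R]_n) : u *m B = 0 -> u *m A = dot u *: delta_mx 0 i.
  move=> uB; apply/rowP => k; rewrite mulA uB (kerB_i uB) !mxE mul0r !add0r mulrC eqxx.
  by [].
have dot_root (w : 'rV[R]_n) u : u *m B = 0 -> (u *m A *m w^T) 0 0 = dot u * w 0 i.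
  move=> uB; rewrite uA // -scalemxAl mxE; congr (_ * _).
  rewrite mxE (bigD1 i) //= big1 ?addr0 => [|k /negPf nk]; first by rewrite !mxE !eqxx mul1r.
  by rewrite !mxE nk andbF mul0r.
have A_S : in_S G A.
  split; first by apply/matrixP => k l; rewrite mxE A_sym.
  move=> k l nkl; rewrite mxE.
  case: (eqVneq k i) nkl => [->|nk] nkl.
    by rewrite b_i mulr0 addr0 mul1r B_i ?add0r ?b_adj // eq_sym.
  have [El|nl] := eqVneq l i; last by rewrite !mul0r !addr0 B_adj.
  by rewrite mul0r mul1r addr0 El B_sym B_i // add0r b_adj adj_sym.
exists A; split=> //.
  congr (_, _).
    (* The combination of [u1] and [u2] on which [dot] vanishes; on the kernel of [B], this is the
       one condition that the border adds. *)
    pose z := dot u2 *: u1 + (- dot u1) *: u2.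
    apply: (nullity1P (u := z)).
    - by apply: contraNneq nub => /indep[_ /eqP]; rewrite oppr_eq0.
    - have zB : z *m B = 0 by rewrite mulmxDl -!scalemxAl u1B u2B !scaler0 addr0.
      by rewrite uA // dotD mulNr [dot u2 * _]mulrC subrr scale0r.
    (* Since [u1 *m A] is [dot u1] times the unit vector at [i], pairing it with a kernel vector of
       [A] isolates the entry at [i]. *)
    move=> w wA; have wi : w 0 i = 0.
      have := dot_root w _ u1B; rewrite -mulmxA.
      have -> : A *m w^T = (w *m A)^T.
        by rewrite trmx_mul; congr (_ *m _); apply/matrixP => k l; rewrite [RHS]mxE A_sym.
      rewrite wA trmx0 mulmx0 mxE => /esym/eqP.
      by rewrite mulf_eq0 (negPf nub) => /eqP.
    have wB : w *m B = 0 by apply: kerA_B => // k _; rewrite wA mxE.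
    have [a [c Ew]] := kerB wB.
    have : dot w = 0.
      by have := mulA w i; rewrite wA wB wi !mxE eqxx mul0r !add0r mul1r => <-.
    rewrite Ew dotD => /eqP; rewrite addr_eq0 => /eqP Ea; exists (- c / dot u1).
    rewrite /z scalerDr !scalerA; congr (_ *: _ + _ *: _).
      by apply: (mulIf nub); rewrite Ea; field.
    by field.
  apply: (nullity2P (u1 := col' i u1) (u2 := col' i u2)).
  - move=> a c E; apply: indep; rewrite -[_ + _](@lift_row_col' _ _ i).
      by rewrite linearD !linearZ /= E; apply/rowP => k; rewrite !mxE; case: unlift => // ?; rewrite mxE.
    by rewrite !mxE u1i u2i !mulr0 addr0.
  - by apply/deleted_kernel => // k nk; rewrite mulA_root // u1B mxE.
  - by apply/deleted_kernel => // k nk; rewrite mulA_root // u2B mxE.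
  move=> w wA; have wi := lift_row_root i w; rewrite -(col'_lift_row i w) in wA *.
  have [a [c ->]] := kerB (kerA_B _ wi (proj1 (deleted_kernel A wi) wA)).
  by exists a, c; rewrite linearD !linearZ.
move=> X X_tr AX IX rowX.
have X_sym k l : X k l = X l k by rewrite -{1}X_tr mxE.
have X_diag k : X k k = 0.
  by move/matrixP/(_ k k): IX; rewrite !mxE eqxx mul1r.
have AX0 k l : k != i -> (A *m X) k l = 0.
  by case: (unliftP i k) => [k' ->|->]; rewrite ?eqxx // => _; move/matrixP/(_ k' l): rowX; rewrite !mxE.
have Xi l : X i l = 0.
  (* Only row [i] of [A *m X] can be nonzero, and [u1 i = 0]; regrouped, [u1 *m A] extracts a
     nonzero multiple of row [i] of [X]. *)
  have : (u1 *m (A *m X)) 0 l = 0.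
    rewrite mxE big1 // => k _; have [->|nk] := eqVneq k i; first by rewrite u1i mul0r.
    by rewrite AX0 // mulr0.
  rewrite mulmxA uA // -scalemxAl -rowE !mxE => /eqP.
  by rewrite mulf_eq0 (negPf nub) => /eqP.
apply: strong => //.
  move=> l; apply: kerA_B => [|k nk]; first by rewrite mxE X_sym Xi.
  rewrite -(AX0 k l nk) !mxE; apply: eq_bigr => m _.
  by rewrite mxE mulrC A_sym X_sym.
move=> k l nk nl kl; have nkl := edge_neq (@adj_irr _ G) kl.
move/matrixP/(_ k l): AX; rewrite !mxE => /eqP; rewrite mulf_eq0 => /orP[|/eqP//].
by rewrite (negPf nk) (negPf nl) !mul0r !addr0 => /eqP B0; have := B_adj nkl nk nl; rewrite B0 eqxx kl.
Qed.

End BorderedMatrix.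

(** * Grounded Laplacians *)

Section Laplacian.
Import GRing.Theory Num.Theory.
Local Open Scope ring_scope.
Variables (R : realType) (n : nat) (g : rel 'I_n) (d : pred 'I_n).
Hypothesis g_sym : symmetric g.

(** Each vertex of [d] is grounded, as if joined by a unit edge to an outer vertex of potential 0;
    this removes its component from the kernel. *)
Definition laplacian : 'M[R]_n := \matrix_(k, l)
  ((k == l)%:R * (\sum_m (g k m)%:R + (d k)%:R) - (g k l)%:R).

Lemma laplacian_sym k l : laplacian k l = laplacian l k.
Proof. by rewrite !mxE g_sym eq_sym; case: eqVneq => [->|]; rewrite ?mul0r. Qed.

Lemma mul_laplacian (w : 'rV[R]_n) l :
  (w *m laplacian) 0 l = \sum_k (g k l)%:R * (w 0 l - w 0 k) + (d l)%:R * w 0 l.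
Proof.
pose D k : R := \sum_m (g k m)%:R + (d k)%:R.
have diag : \sum_k w 0 k * ((k == l)%:R * D k) = w 0 l * D l.
  rewrite (bigD1 l) //= eqxx mul1r big1 ?addr0 // => k /negPf->.
  by rewrite mul0r mulr0.
rewrite mxE; under eq_bigr do rewrite mxE mulrBr; rewrite sumrB diag mulrDr addrAC.
rewrite [(d l)%:R * _]mulrC; congr (_ + _).
under [in RHS]eq_bigr do rewrite mulrBr; rewrite sumrB; congr (_ - _).
  by rewrite mulrC big_distrl /=; apply: eq_bigr => k _; rewrite g_sym.
by apply: eq_bigr => k _; rewrite mulrC.
Qed.

Lemma laplacian_const (w : 'rV[R]_n) : (forall k l, g k l -> w 0 k = w 0 l) ->
  (forall l, d l -> w 0 l = 0) -> w *m laplacian = 0.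
Proof.
move=> wg wd; apply/rowP => l; rewrite mul_laplacian [RHS]mxE big1 ?add0r => [|k _].
  by case: (boolP (d l)) => [/wd->|_]; rewrite ?mulr0 ?mul0r.
by case: (boolP (g k l)) => [/wg->|_]; rewrite ?subrr ?mulr0 ?mul0r.
Qed.

(* Twice the quadratic form is the sum of the [(w k - w l)^2] over the edges and
   of the [2 (w l)^2] over [d]. *)
Lemma laplacian_form0 (w : 'rV[R]_n) : \sum_l (w *m laplacian) 0 l * w 0 l = 0 ->
  (forall k l, g k l -> w 0 k = w 0 l) /\ (forall l, d l -> w 0 l = 0).
Proof.
move=> form0; pose q k l := (g k l)%:R * (w 0 l - w 0 k) ^+ 2.
have q_ge0 k l : 0 <= q k l by rewrite mulr_ge0 ?sqr_ge0.
pose D := \sum_l (d l)%:R * w 0 l ^+ 2.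
have D_ge0 l : 0 <= (d l)%:R * w 0 l ^+ 2 by rewrite mulr_ge0 ?sqr_ge0.
pose S := \sum_l \sum_k (g k l)%:R * (w 0 l - w 0 k) * w 0 l.
have formE : S + D = 0.
  rewrite -form0 /S /D -big_split /=; apply: eq_bigr => l _.
  by rewrite mul_laplacian mulrDl big_distrl /= expr2 mulrA.
have SE : S + S = \sum_l \sum_k q k l.
  rewrite {2}/S exchange_big -big_split /=; apply: eq_bigr => l _.
  rewrite -big_split /=; apply: eq_bigr => k _; rewrite /q [g l k]g_sym; ring.
have Q_ge0 : 0 <= \sum_l \sum_k q k l by apply: sumr_ge0 => l _; apply: sumr_ge0.
have D0' : 0 <= D by apply: sumr_ge0.
have Q0 : \sum_l \sum_k q k l = 0 by lra.
have D0 : D = 0 by lra.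
split=> [k l gkl|l dl].
  have /(_ l isT) Ql := psumr_eq0P (fun l _ => sumr_ge0 _ (fun k _ => q_ge0 k l)) Q0.
  have /(_ k isT)/eqP := psumr_eq0P (fun k _ => q_ge0 k l) Ql.
  by rewrite /q gkl mul1r sqrf_eq0 subr_eq0 => /eqP.
have /(_ l isT)/eqP := psumr_eq0P (fun l _ => D_ge0 l) D0.
by rewrite dl mul1r sqrf_eq0 => /eqP.
Qed.

Lemma laplacian_ker (w : 'rV[R]_n) : w *m laplacian = 0 ->
  (forall k l, g k l -> w 0 k = w 0 l) /\ (forall l, d l -> w 0 l = 0).
Proof.
by move=> w0; apply: laplacian_form0; rewrite w0 big1 // => l _; rewrite mxE mul0r.
Qed.

End Laplacian.

(** * Matrices for obstructed graphs *)

Section ObstructedAllows.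
Import Order.TTheory GRing.Theory Num.Theory.
Local Open Scope ring_scope.
Variables (R : realType) (n : nat) (G : sgraph 'I_n) (i : 'I_n).
Hypothesis G_conn : connected_graph G.

Let H := RGraph G i.
Let e : rel 'I_n := @unrooted_adj H.
Let e_sym : symmetric e := @unrooted_sym H.
Let e_irr : irreflexive e := @unrooted_irr H.

Let e_i k : e i k = false.
Proof. by rewrite /e /unrooted_adj /avoid eqxx. Qed.

Let e_adj k l : k != i -> l != i -> e k l = adj G k l.
Proof. by move=> nk nl; rewrite /e /unrooted_adj /avoid nk nl. Qed.

Lemma nat_bool_neq0 (b : bool) : (b%:R != 0 :> R) = b.
Proof. by case: b; rewrite ?oner_eq0 ?eqxx. Qed.

(* Subtracting the edge [pq] from the Laplacian of the rest, with weight its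
   effective conductance, makes the potential [t] of a unit flow from [p] to [q]
   a second kernel vector. *)
Lemma nonbridge_allows : nonbridge_edge e -> allows_with_SNIP R G i 1 2.
Proof.
move=> [p [q [epq cpq]]].
have npq := edge_neq e_irr epq; have [npi nqi _] := and3P epq.
pose g := delete_edge e p q; have g_sym : symmetric g by apply: delete_edge_sym.
pose C : pred 'I_n := connect e p.
have connect_g k : C k -> connect g p k.
  apply: connect_sub => a b eab; have [gab|] := boolP (g a b); first exact: connect1.
  rewrite /g /delete_edge eab negbK => /orP[]/andP[/eqP-> /eqP->] //.
  by rewrite connectC.
have C_e a b : e a b -> C a = C b.
  by move=> eab; apply: same_connect_r; rewrite ?connect1 //; apply: sym_connect_sym.
have Cp : C p by apply: connect0.
have Cq : C q by apply: connect1.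
have Ci : C i = false by apply/negP => /connect_avoid_neq/(_ npi); rewrite eqxx.
(* Grounding everything off the component of [p], the root included, leaves the constants on that
   component as the whole kernel. *)
pose d : pred 'I_n := predC C.
have d_i : d i by rewrite -[d i]/(~~ C i) Ci.
pose M : 'M[R]_n := laplacian R g d.
have M_sym k l : M k l = M l k by apply: laplacian_sym.
pose one : 'rV[R]_n := \row_k (C k)%:R.
have oneM : one *m M = 0.
  apply: laplacian_const => // [k l /delete_edge_sub /C_e E|l]; first by rewrite !mxE E.
  by rewrite mxE /= => /negPf->.
have kerM (w : 'rV[R]_n) : w *m M = 0 -> w = w 0 p *: one.
  move=> /laplacian_ker[] // wg wd; apply/rowP => k; rewrite !mxE.
  case: (boolP (C k)) => [Ck|nCk]; last by rewrite mulr0 wd.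
  rewrite mulr1; apply/esym.
  by apply: (connect_invariant (P := fun k => w 0 p = w 0 k)) (connect_g k Ck) _ => // a b -> /wg.
pose u : 'rV[R]_n := \row_k ((k == p)%:R - (k == q)%:R).
have mul_u (w : 'rV[R]_n) : \sum_k u 0 k * w 0 k = w 0 p - w 0 q.
  under eq_bigr do rewrite mxE mulrBl; rewrite sumrB (bigD1 p) //= [X in _ - X](bigD1 q) //=.
  rewrite !eqxx !mul1r !big1 ?addr0 // => k /negPf->; exact: mul0r.
(* The image of a symmetric matrix is the orthogonal complement of its kernel, and [u] is orthogonal
   to [one]. *)
have [t tM] : exists t : 'rV[R]_n, t *m M = u.
  suff /submxP[t ->] : (u <= M)%MS by exists t.
  rewrite submxE; apply/eqP/rowP => m; rewrite [RHS]mxE mxE.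
  pose c : 'rV[R]_n := \row_k (cokermx M) k m.
  transitivity (\sum_k u 0 k * c 0 k); first by apply: eq_bigr => k _; rewrite [c _ _]mxE.
  have /kerM -> : c *m M = 0.
    apply/rowP => l; rewrite [RHS]mxE.
    move/matrixP/(_ l m): (mulmx_coker M); rewrite !mxE => E; rewrite -[RHS]E.
    by apply: eq_bigr => k _; rewrite [c _ _]mxE mulrC M_sym.
  by rewrite mul_u !mxE Cp Cq subrr.
(* The effective resistance between [p] and [q], which is also the quadratic form at [t]; were it 0,
   then [t] would be a kernel vector. *)
pose s := t 0 p - t 0 q.
have ns : s != 0.
  apply/eqP => s0; have form0 : \sum_l (t *m M) 0 l * t 0 l = 0 by rewrite tM mul_u.
  have [tg td] := laplacian_form0 g_sym form0.
  have := laplacian_const g_sym tg td; rewrite -/M tM => /rowP/(_ p).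
  by rewrite !mxE eqxx (negPf npq) subr0 => /eqP; rewrite oner_eq0.
pose B : 'M[R]_n := \matrix_(k, l) (M k l - s^-1 * u 0 k * u 0 l).
have mulB (w : 'rV[R]_n) : w *m B = w *m M - (s^-1 * (w 0 p - w 0 q)) *: u.
  apply/rowP => l; rewrite -mul_u [LHS]mxE [RHS]mxE [X in X + _]mxE [X in _ + X]mxE [X in _ - X]mxE.
  rewrite big_distrr big_distrl -sumrB /=; apply: eq_bigr => k _.
  by rewrite [B k l]mxE; ring.
have indep (w : 'rV[R]_n) a c : w = a *: one + c *: t -> w 0 p = 0 -> w 0 q = 0 -> a = 0 /\ c = 0.
  move=> ->; rewrite !mxE Cp Cq !mulr1 => Ep Eq.
  have c0 : c = 0.
    apply/eqP; have : c * s = 0 by rewrite /s mulrBr; lra.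
    by move/eqP; rewrite mulf_eq0 (negPf ns) orbF.
  by split=> //; move: Ep; rewrite c0; lra.
have kerB (w : 'rV[R]_n) : w *m B = 0 -> exists a c, w = a *: one + c *: t.
  rewrite mulB; set c := _ * _ => /eqP; rewrite subr_eq0 => /eqP wM.
  have /kerM : (w - c *: t) *m M = 0 by rewrite mulmxBl -scalemxAl tM wM subrr.
  by move=> E; exists ((w - c *: t) 0 p), c; rewrite -E subrK.
have kerB0 (w : 'rV[R]_n) : w *m B = 0 -> w 0 p = 0 -> w 0 q = 0 -> w = 0.
  move=> /kerB[a [c Ew]] wp wq; have [a0 c0] := indep _ _ _ Ew wp wq.
  by rewrite Ew a0 c0 !scale0r addr0.
have u_i : u 0 i = 0 by rewrite mxE !(eq_sym i) (negPf npi) (negPf nqi) subrr.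
have g_i k : g i k = false by rewrite /g /delete_edge e_i.
have [z [nz cpz zi]] := first_hit (G_conn p i) npi.
apply: (allows_bordered (B := B) (u1 := one) (u2 := t) (j := z)).
- by move=> k l; rewrite !mxE g_sym eq_sym; case: (eqVneq k l) => [->|_] //; rewrite !mul0r; ring.
- rewrite !mxE eqxx g_i !(eq_sym i) (negPf npi) (negPf nqi) subrr mulr0 !subr0 mul1r d_i.
  by rewrite big1 ?add0r // => m _; rewrite g_i.
- by move=> k nk; rewrite mxE u_i mulr0 mul0r subr0 mxE g_i eq_sym (negPf nk) mul0r subrr.
- move=> k l nkl nk nl; rewrite mxE [M k l]mxE (negPf nkl) mul0r add0r.
  rewrite -e_adj // /g /delete_edge !mxE.
  have [Ekp|nkp] := eqVneq k p; have [Elq|nlq] := eqVneq l q => /=.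
  + rewrite Ekp Elq epq (eq_sym q p) (negPf npq) /= subr0 sub0r oppr0 add0r !mulr1 mulrN1 opprK.
    by rewrite invr_eq0 ns.
  + have -> : (l == p) = false by rewrite -Ekp eq_sym (negPf nkl).
    by rewrite andbF /= subrr mulr0 subr0 andbT oppr_eq0 nat_bool_neq0.
  + have -> : (k == q) = false by rewrite -Elq (negPf nkl).
    by rewrite /= subrr mulr0 mul0r subr0 andbT oppr_eq0 nat_bool_neq0.
  + have [Ekq|nkq] := eqVneq k q; have [Elp|nlp] := eqVneq l p => /=.
    * by rewrite Ekq Elp e_sym epq /= sub0r subr0 oppr0 add0r mulr1 mulrN1 opprK invr_eq0 ns.
    * by rewrite !(subrr, mulr0, mul0r) subr0 andbT oppr_eq0 nat_bool_neq0.
    * by rewrite !(subrr, mulr0, mul0r) subr0 andbT oppr_eq0 nat_bool_neq0.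
    * by rewrite !(subrr, mulr0, mul0r) subr0 andbT oppr_eq0 nat_bool_neq0.
- move=> a c E; apply: (indep 0) => //; by rewrite mxE.
- by rewrite mulB oneM !mxE Cp Cq subrr mulr0 scale0r subr0.
- by rewrite mulB tM -/s mulVf // scale1r subrr.
- exact: kerB.
- by rewrite adj_sym.
- by rewrite mxE /C cpz oner_eq0.
move=> X X_sym XB X_diag X_e.
(* A kernel vector of [B] with zeros at [p] and [q] is zero. Rows [p] and [q] of [X] have these
   zeros from the diagonal and the edge [pq]; by symmetry, so does then every row. *)
have Xpq : X p q = 0 by apply: X_e; rewrite // -e_adj.
have row_p : row p X = 0 by apply: kerB0; rewrite // mxE.
have row_q : row q X = 0 by apply: kerB0; rewrite // mxE // X_sym.
have Xp l : X l p = 0 by rewrite X_sym; move/rowP/(_ l): row_p; rewrite !mxE.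
have Xq l : X l q = 0 by rewrite X_sym; move/rowP/(_ l): row_q; rewrite !mxE.
apply/row_matrixP => k; rewrite row0; apply: kerB0 => //; by rewrite mxE.
Qed.

Section Branching.
Variables (j b s1 s2 s3 : 'I_n).
Let h : rel 'I_n := avoid e b.
Let S (s : 'I_n) : pred 'I_n := connect h s.
Hypotheses (bs1 : e b s1) (bs2 : e b s2) (bs3 : e b s3)
  (S12 : ~~ S s1 s2) (S13 : ~~ S s1 s3) (S23 : ~~ S s2 s3)
  (ij : adj G i j) (S1j : S s1 j).

Let h_sym : symmetric h. Proof. exact: avoid_sym. Qed.

Let S_h s a c : h a c -> S s a = S s c.
Proof. by move=> hac; apply: same_connect_r; rewrite ?connect1 //; apply: sym_connect_sym. Qed.

Let S_disj s s' k : ~~ S s s' -> S s k -> S s' k = false.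
Proof.
move=> nS Ssk; apply: contraNF nS => Ss'k; apply: connect_trans Ssk _.
by rewrite connectC.
Qed.

Let S_i s : e b s -> S s i = false.
Proof.
case/and3P=> _ ns _; apply/negP => c.
have : connect e s i by apply: connect_sub c => ? ? /avoid_sub; apply: connect1.
by move/connect_avoid_neq/(_ ns); rewrite eqxx.
Qed.

Let S_b s : e b s -> S s b = false.
Proof.
move=> ebs; apply/negP => /connect_avoid_neq; rewrite eqxx eq_sym.
by rewrite (edge_neq e_irr ebs) => /(_ isT).
Qed.

Let nbi : b != i. Proof. by case/and3P: bs1. Qed.

Let d : pred 'I_n := fun k => [&& k != b, ~~ S s1 k, ~~ S s2 k & ~~ S s3 k].
Let M : 'M[R]_n := laplacian R h d.
(** [b] is attached, with diagonal entry 0, to the Laplacian of [G - i - b], grounded off the three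
    branches. Thus the indicator [f s] of a branch is mapped to [m s] times the unit vector at [b],
    where [m s] counts the neighbours of [b] in that branch. *)
Let B : 'M[R]_n :=
  \matrix_(k, l) (M k l + (k == b)%:R * (e b l)%:R + (l == b)%:R * (e b k)%:R).
Let f s : 'rV[R]_n := \row_k (S s k)%:R.
Let dot (w : 'rV[R]_n) : R := \sum_l w 0 l * (e b l)%:R.
Let m s := dot (f s).

Let mulB (w : 'rV[R]_n) k :
  (w *m B) 0 k = (w *m M) 0 k + w 0 b * (e b k)%:R + (k == b)%:R * dot w.
Proof.
rewrite [LHS]mxE [X in X + _ + _]mxE.
have -> : w 0 b * (e b k)%:R = \sum_l w 0 l * ((l == b)%:R * (e b k)%:R).
  rewrite (bigD1 b) //= eqxx mul1r big1 ?addr0 // => l /negPf->.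
  by rewrite mul0r mulr0.
rewrite /dot big_distrr -!big_split /=; apply: eq_bigr => l _.
by rewrite [B l k]mxE !mulrDr [(k == b)%:R * (_ * _)]mulrCA.
Qed.

Let fM s : s \in [:: s1; s2; s3] -> f s *m M = 0.
Proof.
move=> sP; apply: laplacian_const => // [k l hkl|l /and4P[_ n1 n2 n3]].
  by rewrite !mxE (S_h _ hkl).
by rewrite mxE; move: sP; rewrite !inE => /or3P[]/eqP->; rewrite (negPf n1, negPf n2, negPf n3).
Qed.

Let m_gt0 s : e b s -> 0 < m s.
Proof.
move=> bs; rewrite /m /dot (bigD1 s) //= mxE /S connect0 bs mulr1 ltr_pwDl ?ltr01 //.
by apply: sumr_ge0 => k _; rewrite mulr_ge0 // mxE.
Qed.

Let dotD (x y : 'rV[R]_n) a c : dot (a *: x + c *: y) = a * dot x + c * dot y.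
Proof.
rewrite /dot !big_distrr -big_split /=; apply: eq_bigr => k _.
by rewrite !mxE mulrDl !mulrA.
Qed.

Let kerB (w : 'rV[R]_n) : w *m B = 0 ->
  w = w 0 s1 *: f s1 + (w 0 s2 *: f s2 + w 0 s3 *: f s3) /\
  w 0 s1 * m s1 + (w 0 s2 * m s2 + w 0 s3 * m s3) = 0.
Proof.
move=> wB.
have wBk k : (w *m M) 0 k + w 0 b * (e b k)%:R + (k == b)%:R * dot w = 0.
  by rewrite -mulB wB mxE.
(* Pairing [w *m B] with [f s1] leaves only [w b * m s1]. *)
have wb : w 0 b = 0.
  have : \sum_k (w *m B) 0 k * f s1 0 k = w 0 b * m s1.
    under eq_bigr do rewrite mulB mulrDl; rewrite big_split /=.
    rewrite [X in _ + X]big1 ?addr0 => [|k _]; last first.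
      have [->|_] := eqVneq k b; last by rewrite !mul0r.
      by rewrite [f _ _ _]mxE S_b // mulr0.
    under eq_bigr do rewrite mulrDl; rewrite big_split /=.
    have -> : \sum_k (w *m M) 0 k * f s1 0 k = (w *m M *m (f s1)^T) 0 0.
      by rewrite [RHS]mxE; apply: eq_bigr => k _; rewrite [(f s1)^T _ _]mxE.
    have -> : w *m M *m (f s1)^T = 0.
      have MT : M^T = M by apply/matrixP => k l; rewrite mxE; apply: laplacian_sym.
      by rewrite -mulmxA -{1}MT -trmx_mul fM ?mem_head // trmx0 mulmx0.
    by rewrite mxE add0r /m /dot big_distrr /=; apply: eq_bigr => k _; rewrite mulrAC mulrA.
  rewrite wB big1 => [|k _]; last by rewrite mxE mul0r.
  by move/esym/eqP; rewrite mulf_eq0 (gt_eqF (m_gt0 bs1)) orbF => /eqP.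
have M_b k : M k b = 0.
  have h_b l : h b l = false by rewrite /h /avoid eqxx.
  have d_b : d b = false by rewrite /d eqxx.
  rewrite mxE h_sym h_b subr0; have [->|_] := eqVneq k b; last by rewrite mul0r.
  by rewrite d_b big1 ?addr0 ?mulr0 // => l _; rewrite h_b.
have wM : w *m M = 0.
  apply/rowP => k; rewrite [RHS]mxE; have [->|nk] := eqVneq k b.
    by rewrite mxE big1 // => l _; rewrite M_b mulr0.
  by have := wBk k; rewrite wb (negPf nk) !mul0r !addr0.
have [wh wd] := laplacian_ker h_sym wM.
have wS s k : S s k -> w 0 k = w 0 s.
  by move=> c; apply: (connect_invariant (P := fun k => w 0 k = w 0 s)) c _ => // x y <- /wh.
have Ew : w = w 0 s1 *: f s1 + (w 0 s2 *: f s2 + w 0 s3 *: f s3).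
  apply/rowP => k; rewrite !mxE.
  have [S1|n1] := boolP (S s1 k).
    by rewrite (S_disj S12 S1) (S_disj S13 S1) (wS _ _ S1) !mulr0 !addr0 mulr1.
  have [S2|n2] := boolP (S s2 k).
    by rewrite (S_disj S23 S2) (wS _ _ S2) !mulr0 !addr0 add0r mulr1.
  have [S3|n3] := boolP (S s3 k); first by rewrite (wS _ _ S3) !mulr0 !add0r mulr1.
  rewrite !mulr0 !addr0; have [->//|nk] := eqVneq k b.
  by apply: wd; rewrite /d nk n1 n2 n3.
split=> //; have := wBk b; rewrite wM wb mxE eqxx mul0r !add0r mul1r.
by rewrite {1}Ew -[X in _ + X]scale1r !dotD mul1r.
Qed.

Let kerB0 (w : 'rV[R]_n) : w *m B = 0 -> w 0 s1 = 0 -> w 0 s2 = 0 -> w 0 s3 = 0 -> w = 0.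
Proof. by move=> /kerB[Ew _] w1 w2 w3; rewrite Ew w1 w2 w3 !scale0r !addr0. Qed.

Let f_ker x y s s' : s \in [:: s1; s2; s3] -> s' \in [:: s1; s2; s3] ->
  e b s -> e b s' -> x * m s + y * m s' = 0 -> (x *: f s + y *: f s') *m B = 0.
Proof.
move=> sP s'P bs bs' xy0; apply/rowP => k; rewrite mulB dotD -!/(m _) xy0.
rewrite mulmxDl -!scalemxAl !fM // !scaler0 addr0 !mxE !S_b //.
by rewrite !(mulr0, mul0r, addr0).
Qed.

Lemma branching_allows : allows_with_SNIP R G i 1 2.
Proof.
have m1 := m_gt0 bs1; have m2 := m_gt0 bs2; have m3 := m_gt0 bs3.
have n1 : m s1 != 0 by rewrite gt_eqF.
have h_i k : h i k = false by rewrite /h /avoid e_i !andbF.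
have e_bi : e b i = false by rewrite e_sym e_i.
(* By [kerB] the kernel is the plane [x1 * m s1 + x2 * m s2 + x3 * m s3 = 0] in the branch values;
   [u1] and [u2] form a basis of it. *)
pose u1 := m s2 *: f s1 + (- m s1) *: f s2.
pose u2 := m s3 *: f s1 + (- m s1) *: f s3.
have sP1 : s1 \in [:: s1; s2; s3] by rewrite !inE eqxx.
have sP2 : s2 \in [:: s1; s2; s3] by rewrite !inE eqxx orbT.
have sP3 : s3 \in [:: s1; s2; s3] by rewrite !inE eqxx !orbT.
have S0 s : S s s by apply: connect0.
apply: (allows_bordered (B := B) (u1 := u1) (u2 := u2) (j := j)).
- move=> k l; rewrite [LHS]mxE [RHS]mxE /M laplacian_sym // -!addrA; congr (_ + _).
  by rewrite addrC.
- rewrite mxE e_bi !mulr0 !addr0 mxE eqxx h_i subr0 mul1r /d !S_i // eq_sym nbi /=.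
  by rewrite big1 ?add0r // => l _; rewrite h_i.
- move=> k nk; rewrite mxE [_ == b]eq_sym (negPf nbi) e_bi mulr0 mul0r !addr0 mxE h_i.
  by rewrite eq_sym (negPf nk) mul0r subrr.
- move=> k l nkl nk nl; rewrite mxE [M k l]mxE (negPf nkl) mul0r add0r -e_adj // /h /avoid.
  have [Ek|nkb] := eqVneq k b; have [El|nlb] := eqVneq l b => /=.
  + by rewrite Ek El eqxx in nkl.
  + by rewrite Ek oppr0 add0r mul1r mul0r addr0 nat_bool_neq0.
  + by rewrite El oppr0 add0r mul1r mul0r add0r nat_bool_neq0 e_sym.
  + by rewrite !mul0r !addr0 oppr_eq0 nat_bool_neq0.
- move=> a c E; have E2 := congr1 (fun w : 'rV_n => w 0 s2) E.
  have E3 := congr1 (fun w : 'rV_n => w 0 s3) E; move: E2 E3; rewrite !mxE !S0.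
  rewrite (negPf S12) (negPf S13) (negPf S23) [S s3 s2]connectC // -/(S s2 s3) (negPf S23).
  rewrite !(mulr0, mulr1, add0r, addr0) => /eqP; rewrite mulf_eq0 oppr_eq0 (negPf n1) orbF => /eqP ->.
  by move=> /eqP; rewrite ?mul0r ?add0r mulf_eq0 oppr_eq0 (negPf n1) orbF => /eqP ->.
- by apply: f_ker => //; rewrite mulrC mulNr subrr.
- by apply: f_ker => //; rewrite mulrC mulNr subrr.
- move=> w /kerB[Ew w0]; exists (- w 0 s2 / m s1), (- w 0 s3 / m s1).
  rewrite {1}Ew /u1 /u2 !scalerDr !scalerA addrACA -scalerDl; congr (_ *: _ + (_ *: _ + _ *: _)).
  + apply: (mulIf n1); transitivity (- (w 0 s2 * m s2 + w 0 s3 * m s3)); first by lra.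
    by field.
  + by field.
  + by field.
- exact: ij.
- by rewrite !mxE S1j (S_disj S12 S1j) mulr1 mulr0 addr0 gt_eqF.
move=> X X_sym XB X_diag X_e.
have row_sum k : X k s1 * m s1 + (X k s2 * m s2 + X k s3 * m s3) = 0.
  by have [_] := kerB (XB k); rewrite !mxE.
have := row_sum s1; have := row_sum s2; have := row_sum s3.
rewrite !X_diag (X_sym s2 s1) (X_sym s3 s1) (X_sym s3 s2) => E3 E2 E1.
(* With zero diagonal, the three row sums are equations in three unknowns; [E2] times [m s2] plus
   [E3] times [m s3] minus [E1] times [m s1] is [2 * X s2 s3 * m s2 * m s3 = 0]. *)
have x23 : X s2 s3 = 0.
  have : X s2 s3 * (m s2 * m s3) = 0 by nra.
  by move/eqP; rewrite !mulf_eq0 (gt_eqF m2) (gt_eqF m3) !orbF => /eqP.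
have x12 : X s1 s2 = 0.
  have : X s1 s2 * m s1 = 0 by move: E2; rewrite x23; lra.
  by move/eqP; rewrite mulf_eq0 (gt_eqF m1) orbF => /eqP.
have x13 : X s1 s3 = 0.
  have : X s1 s3 * m s1 = 0 by move: E3; rewrite x23; lra.
  by move/eqP; rewrite mulf_eq0 (gt_eqF m1) orbF => /eqP.
have row1 : row s1 X = 0 by apply: kerB0; rewrite // mxE.
have row2 : row s2 X = 0 by apply: kerB0; rewrite // mxE // X_sym.
have row3 : row s3 X = 0 by apply: kerB0; rewrite // mxE // X_sym.
have colX s k : row s X = 0 -> X k s = 0.
  by move/rowP/(_ k); rewrite !mxE X_sym.
apply/row_matrixP => k; rewrite row0.
by apply: kerB0 => //; rewrite mxE colX.
Qed.

End Branching.

Lemma obstructed_allows : obstructed H -> allows_with_SNIP R G i 1 2.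
Proof.
have [cyc _|acyclic] := pselect (cyclic_vertex e).
  exact/nonbridge_allows/cyclic_vertex_nonbridge.
case=> [/(nonbridge_cyclic_vertex e_sym e_irr)//|[j [b [ij njb cjb]]]]; rewrite -/e => degb.
(* [s1] is the neighbour of [b] on the side of [j]; acyclicity puts different neighbours of [b] into
   different branches. *)
have [s1 [n1b cj1 e1b]] := first_hit cjb njb; have bs1 : e b s1 by rewrite e_sym.
have : (1 < #|[set y | e b y] :\ s1|)%N.
  by move: degb; rewrite (cardsD1 s1) inE bs1.
move=> /card_gt1P[s2 [s3 [/setD1P[n21 +] /setD1P[n31 +] n23]]].
rewrite !inE => bs2 bs3.
have disj x y : x != y -> e b x -> e b y -> ~~ connect (avoid e b) x y.
  by move=> nxy bx by_; apply/negP => cxy; apply: acyclic; exists b, x, y.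
apply: (branching_allows bs1 bs2 bs3 _ _ _ ij); rewrite ?disj // 1?eq_sym //.
by rewrite connectC //; apply: avoid_sym.
Qed.

End ObstructedAllows.

Theorem theorem5p8 (R : realType) (n : nat) (G : sgraph 'I_n) (i : 'I_n)
    (hG : connected_graph G) :
  (allows_with_SNIP R G i 1 2 <->
     (rooted_minor Paw (RGraph G i) \/ rooted_minor S211 (RGraph G i))) /\
  ((rooted_minor Paw (RGraph G i) \/ rooted_minor S211 (RGraph G i)) <->
     ~ yam_graph (RGraph G i)).
Proof.
have minorP : rooted_minor Paw (RGraph G i) \/ rooted_minor S211 (RGraph G i) <->
    obstructed (RGraph G i).
  split; last exact: obstructed_minor.
  by case; apply: minor_obstructed; [apply: Paw_obstructed | apply: S211_obstructed].
split; split.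
- by case=> A [A_S A_pair A_SNIP]; apply/minorP; apply: allows_obstructed A_S A_pair A_SNIP.
- by move/minorP; apply: obstructed_allows.
- by move=> /minorP obs /yam_not_obstructed; apply.
- move=> nyam; apply/minorP; apply: contrapT => nobs.
  by apply: nyam; apply: not_obstructed_yam.
Qed.
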